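(* Let $p:\mathbb{E}\rightarrow \mathbb{B}$ be a 2-functor between 2-categories. Suppose that $p$ is surjective both on vertically composable triples of horizontally composable pairs of 2-cells and on horizontally composable triples of vertically composable pairs of 2-cells. Then $p$ is an effective descent morphism in the category $2Cat$.
   Context: $2Cat$ denotes the category of all (small, strict) 2-categories and (strict) 2-functors. A morphism $p:E\rightarrow B$ in a category $\mathbb{C}$ with pullbacks is an effective descent morphism if the pullback functor $p^{*}:\mathbb{C}/B\rightarrow\mathbb{C}/E$ is monadic. A vertically composable triple of horizontally composable pairs of 2-cells in a 2-category $\mathbb{B}$ consists of objects $b_0,b_1,b_2$, 1-cells $f_0,f_1,f_2,f_3:b_0\to b_1$ and $g_0,g_1,g_2,g_3:b_1\to b_2$, and 2-cells $\alpha_i:f_{i-1}\Rightarrow f_i$ and $\beta_i:g_{i-1}\Rightarrow g_i$ for $i=1,2,3$. A horizontally composable triple of vertically composable pairs of 2-cells in $\mathbb{B}$ consists of objects $b_0,b_1,b_2,b_3$ and, for each $j=1,2,3$, 1-cells $f_{j,0},f_{j,1},f_{j,2}:b_{j-1}\to b_j$ and 2-cells $\alpha_{j,i}:f_{j,i-1}\Rightarrow f_{j,i}$ for $i=1,2$. A 2-functor $p:\mathbb{E}\to\mathbb{B}$ is surjective on configurations of one of these kinds if every such configuration in $\mathbb{B}$ is the image under $p$ of a configuration of the same kind in $\mathbb{E}$. *)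

(* Defs.v *)
(* Equality of objects, morphisms and cells is Leibniz equality throughout. *)
From Stdlib Require Import FunctionalExtensionality ProofIrrelevance.

Set Implicit Arguments.
Unset Strict Implicit.
Unset Printing Implicit Defensive.

Record Category := {
  Obj :> Type;
  Hom : Obj -> Obj -> Type;
  idm : forall x, Hom x x;
  comp : forall x y z, Hom y z -> Hom x y -> Hom x z;
  comp_idl : forall x y (f : Hom x y), comp (idm y) f = f;
  comp_idr : forall x y (f : Hom x y), comp f (idm x) = f;
  comp_assoc : forall x y z w (h : Hom z w) (g : Hom y z) (f : Hom x y),
    comp h (comp g f) = comp (comp h g) f
}.

Arguments Hom {c} x y.
Arguments idm {c} x.
Arguments comp {c x y z} g f.
Arguments comp_idl {c x y} f.
Arguments comp_idr {c x y} f.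
Arguments comp_assoc {c x y z w} h g f.

Declare Scope cat_scope.
Delimit Scope cat_scope with cat.
Local Open Scope cat_scope.
Notation "g 'o' f" := (comp g f) (at level 40, left associativity) : cat_scope.

Definition is_iso (C : Category) (x y : C) (f : Hom x y) : Prop :=
  exists g : Hom y x, g o f = idm x /\ f o g = idm y.

Record Functor (C D : Category) := {
  fobj :> C -> D;
  fmap : forall x y, Hom x y -> Hom (fobj x) (fobj y);
  fmap_id : forall x, fmap (idm x) = idm (fobj x);
  fmap_comp : forall x y z (g : Hom y z) (f : Hom x y),
    fmap (g o f) = fmap g o fmap f
}.

Arguments fmap {C D} F {x y} f : rename.
Arguments fmap_id {C D} F x : rename.
Arguments fmap_comp {C D} F {x y z} g f : rename.

Definition functor_id (C : Category) : Functor C C := {|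
  fobj := fun x => x;
  fmap := fun x y f => f;
  fmap_id := fun x => eq_refl;
  fmap_comp := fun x y z g f => eq_refl
|}.

Section FunctorComp.
Variables (C D K : Category) (G : Functor D K) (F : Functor C D).

Lemma functor_comp_id (x : C) : fmap G (fmap F (idm x)) = idm (G (F x)).
Proof. now rewrite !fmap_id. Qed.

Lemma functor_comp_comp (x y z : C) (g : Hom y z) (f : Hom x y) :
  fmap G (fmap F (g o f)) = fmap G (fmap F g) o fmap G (fmap F f).
Proof. now rewrite !fmap_comp. Qed.

Definition functor_comp : Functor C K := {|
  fobj := fun x => G (F x);
  fmap := fun x y f => fmap G (fmap F f);
  fmap_id := functor_comp_id;
  fmap_comp := functor_comp_comp
|}.
End FunctorComp.

Record NatTrans (C D : Category) (F G : Functor C D) := {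
  component :> forall x : C, Hom (F x) (G x);
  naturality : forall (x y : C) (f : Hom x y),
    component y o fmap F f = fmap G f o component x
}.

Definition is_nat_iso (C D : Category) (F G : Functor C D) (t : NatTrans F G) :
  Prop := forall x, is_iso (t x).

Definition is_equivalence (C D : Category) (F : Functor C D) : Prop :=
  exists (G : Functor D C)
         (t : NatTrans (functor_id C) (functor_comp G F))
         (u : NatTrans (functor_comp F G) (functor_id D)),
    is_nat_iso t /\ is_nat_iso u.

Record Adjunction (A X : Category) (F : Functor X A) (U : Functor A X) := {
  adj_unit : NatTrans (functor_id X) (functor_comp U F);
  adj_counit : NatTrans (functor_comp F U) (functor_id A);
  triangle_left : forall x : X, adj_counit (F x) o fmap F (adj_unit x) = idm (F x);
  triangle_right : forall a : A, fmap U (adj_counit a) o adj_unit (U a) = idm (U a)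
}.

Record Monad (X : Category) := {
  mon_fun :> Functor X X;
  mon_unit : NatTrans (functor_id X) mon_fun;
  mon_mult : NatTrans (functor_comp mon_fun mon_fun) mon_fun;
  mon_unitl : forall x, mon_mult x o mon_unit (mon_fun x) = idm (mon_fun x);
  mon_unitr : forall x, mon_mult x o fmap mon_fun (mon_unit x) = idm (mon_fun x);
  mon_assoc : forall x,
    mon_mult x o mon_mult (mon_fun x) = mon_mult x o fmap mon_fun (mon_mult x)
}.

Arguments mon_unit {X} T : rename.
Arguments mon_mult {X} T : rename.

Section EilenbergMoore.
Variables (X : Category) (T : Monad X).

Record Algebra := {
  alg_obj : X;
  alg_act : Hom (T alg_obj) alg_obj;
  alg_unit : alg_act o mon_unit T alg_obj = idm alg_obj;
  alg_assoc : alg_act o mon_mult T alg_obj = alg_act o fmap T alg_act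
}.

Record AlgebraHom (a b : Algebra) := {
  alg_hom : Hom (alg_obj a) (alg_obj b);
  alg_hom_act : alg_hom o alg_act a = alg_act b o fmap T alg_hom
}.

Lemma AlgebraHom_eq (a b : Algebra) (f g : AlgebraHom a b) :
  alg_hom f = alg_hom g -> f = g.
Proof.
destruct f as [f Hf], g as [g Hg]; simpl; intros e; subst g.
f_equal; apply proof_irrelevance.
Qed.

Lemma alg_id_act (a : Algebra) :
  idm (alg_obj a) o alg_act a = alg_act a o fmap T (idm (alg_obj a)).
Proof. now rewrite fmap_id, comp_idl, comp_idr. Qed.

Definition alg_id (a : Algebra) : AlgebraHom a a :=
  {| alg_hom_act := alg_id_act a |}.

Lemma alg_comp_act (a b c : Algebra) (g : AlgebraHom b c) (f : AlgebraHom a b) :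
  (alg_hom g o alg_hom f) o alg_act a =
  alg_act c o fmap T (alg_hom g o alg_hom f).
Proof.
now rewrite fmap_comp, comp_assoc, <- (alg_hom_act g), <- !comp_assoc,
  (alg_hom_act f).
Qed.

Definition alg_comp (a b c : Algebra) (g : AlgebraHom b c) (f : AlgebraHom a b) :
  AlgebraHom a c := {| alg_hom_act := alg_comp_act g f |}.

Lemma alg_comp_idl (a b : Algebra) (f : AlgebraHom a b) :
  alg_comp (alg_id b) f = f.
Proof. apply AlgebraHom_eq; apply comp_idl. Qed.

Lemma alg_comp_idr (a b : Algebra) (f : AlgebraHom a b) :
  alg_comp f (alg_id a) = f.
Proof. apply AlgebraHom_eq; apply comp_idr. Qed.

Lemma alg_comp_assoc (a b c d : Algebra) (h : AlgebraHom c d)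
    (g : AlgebraHom b c) (f : AlgebraHom a b) :
  alg_comp h (alg_comp g f) = alg_comp (alg_comp h g) f.
Proof. apply AlgebraHom_eq; apply comp_assoc. Qed.

Definition EilenbergMoore : Category := {|
  Obj := Algebra;
  Hom := AlgebraHom;
  idm := alg_id;
  comp := alg_comp;
  comp_idl := alg_comp_idl;
  comp_idr := alg_comp_idr;
  comp_assoc := alg_comp_assoc
|}.
End EilenbergMoore.

Section Comparison.
Variables (A X : Category) (F : Functor X A) (U : Functor A X).
Variable adj : Adjunction F U.

Let eps := adj_counit adj.

Lemma adj_mult_natural (x y : X) (f : Hom x y) :
  fmap U (eps (F y)) o fmap U (fmap F (fmap U (fmap F f))) =
  fmap U (fmap F f) o fmap U (eps (F x)).
Proof. rewrite <- !fmap_comp; f_equal; apply (naturality eps (fmap F f)). Qed.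

Definition adj_mult :
    NatTrans (functor_comp (functor_comp U F) (functor_comp U F))
             (functor_comp U F) :=
  @Build_NatTrans X X (functor_comp (functor_comp U F) (functor_comp U F))
    (functor_comp U F) (fun x => fmap U (eps (F x))) adj_mult_natural.

Lemma adj_mon_unitr (x : X) :
  fmap U (eps (F x)) o fmap U (fmap F (adj_unit adj x)) = idm (U (F x)).
Proof. rewrite <- fmap_comp, <- fmap_id; f_equal; apply (triangle_left adj x). Qed.

Lemma adj_mon_assoc (x : X) :
  fmap U (eps (F x)) o fmap U (eps (F (U (F x)))) =
  fmap U (eps (F x)) o fmap U (fmap F (fmap U (eps (F x)))).
Proof.
rewrite <- !fmap_comp; f_equal; symmetry; apply (naturality eps (eps (F x))).
Qed.

Definition adj_monad : Monad X := {|
  mon_fun := functor_comp U F;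
  mon_unit := adj_unit adj;
  mon_mult := adj_mult;
  mon_unitl := fun x => triangle_right adj (F x);
  mon_unitr := adj_mon_unitr;
  mon_assoc := adj_mon_assoc
|}.

Lemma comparison_assoc (a : A) :
  fmap U (eps a) o fmap U (eps (F (U a))) =
  fmap U (eps a) o fmap U (fmap F (fmap U (eps a))).
Proof.
rewrite <- !fmap_comp; f_equal; symmetry; apply (naturality eps (eps a)).
Qed.

Definition comparison_obj (a : A) : EilenbergMoore adj_monad :=
  @Build_Algebra X adj_monad (U a) (fmap U (eps a))
    (triangle_right adj a) (comparison_assoc a).

Lemma comparison_act (a b : A) (f : Hom a b) :
  fmap U f o fmap U (eps a) = fmap U (eps b) o fmap U (fmap F (fmap U f)).
Proof. rewrite <- !fmap_comp; f_equal; symmetry; apply (naturality eps f). Qed.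

Definition comparison_map (a b : A) (f : Hom a b) :
    Hom (comparison_obj a) (comparison_obj b) :=
  @Build_AlgebraHom X adj_monad (comparison_obj a) (comparison_obj b)
    (fmap U f) (comparison_act f).

Lemma comparison_id (a : A) : comparison_map (idm a) = idm (comparison_obj a).
Proof. apply AlgebraHom_eq; apply fmap_id. Qed.

Lemma comparison_comp (a b c : A) (g : Hom b c) (f : Hom a b) :
  comparison_map (g o f) = comparison_map g o comparison_map f.
Proof. apply AlgebraHom_eq; apply fmap_comp. Qed.

Definition comparison : Functor A (EilenbergMoore adj_monad) := {|
  fobj := comparison_obj;
  fmap := comparison_map;
  fmap_id := comparison_id;
  fmap_comp := comparison_comp
|}.
End Comparison.

(* Monadicity in the up-to-equivalence sense: the comparison functor to the
   Eilenberg-Moore category is an equivalence, not necessarily an isomorphism. *)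
Definition monadic (A X : Category) (U : Functor A X) : Prop :=
  exists (F : Functor X A) (adj : Adjunction F U),
    is_equivalence (comparison adj).

Section Slice.
Variables (C : Category) (B : C).

Record SliceObj := { sl_dom : C; sl_arr : Hom sl_dom B }.

Record SliceHom (x y : SliceObj) := {
  sl_hom : Hom (sl_dom x) (sl_dom y);
  sl_hom_arr : sl_arr y o sl_hom = sl_arr x
}.

Lemma SliceHom_eq (x y : SliceObj) (f g : SliceHom x y) :
  sl_hom f = sl_hom g -> f = g.
Proof.
destruct f as [f Hf], g as [g Hg]; simpl; intros e; subst g.
f_equal; apply proof_irrelevance.
Qed.

Definition slice_id (x : SliceObj) : SliceHom x x :=
  {| sl_hom_arr := comp_idr (sl_arr x) |}.

Lemma slice_comp_arr (x y z : SliceObj) (g : SliceHom y z) (f : SliceHom x y) :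
  sl_arr z o (sl_hom g o sl_hom f) = sl_arr x.
Proof. now rewrite comp_assoc, !sl_hom_arr. Qed.

Definition slice_comp (x y z : SliceObj) (g : SliceHom y z) (f : SliceHom x y) :
  SliceHom x z := {| sl_hom_arr := slice_comp_arr g f |}.

Lemma slice_comp_idl (x y : SliceObj) (f : SliceHom x y) :
  slice_comp (slice_id y) f = f.
Proof. apply SliceHom_eq; apply comp_idl. Qed.

Lemma slice_comp_idr (x y : SliceObj) (f : SliceHom x y) :
  slice_comp f (slice_id x) = f.
Proof. apply SliceHom_eq; apply comp_idr. Qed.

Lemma slice_comp_assoc (x y z w : SliceObj) (h : SliceHom z w)
    (g : SliceHom y z) (f : SliceHom x y) :
  slice_comp h (slice_comp g f) = slice_comp (slice_comp h g) f.
Proof. apply SliceHom_eq; apply comp_assoc. Qed.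

Definition Slice : Category := {|
  Obj := SliceObj;
  Hom := SliceHom;
  idm := slice_id;
  comp := slice_comp;
  comp_idl := slice_comp_idl;
  comp_idr := slice_comp_idr;
  comp_assoc := slice_comp_assoc
|}.
End Slice.

Record Pullback (C : Category) (X E B : C) (q : Hom X B) (p : Hom E B) := {
  pb_obj : C;
  pb_fst : Hom pb_obj X;
  pb_snd : Hom pb_obj E;
  pb_comm : q o pb_fst = p o pb_snd;
  pb_lift : forall (Z : C) (u : Hom Z X) (v : Hom Z E),
    q o u = p o v -> Hom Z pb_obj;
  pb_lift_fst : forall (Z : C) (u : Hom Z X) (v : Hom Z E) (e : q o u = p o v),
    pb_fst o pb_lift e = u;
  pb_lift_snd : forall (Z : C) (u : Hom Z X) (v : Hom Z E) (e : q o u = p o v),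
    pb_snd o pb_lift e = v;
  pb_unique : forall (Z : C) (h k : Hom Z pb_obj),
    pb_fst o h = pb_fst o k -> pb_snd o h = pb_snd o k -> h = k
}.

Definition HasPullbacks (C : Category) : Type :=
  forall (X E B : C) (q : Hom X B) (p : Hom E B), Pullback q p.

Section PullbackFunctor.
Variables (C : Category) (P : HasPullbacks C) (E B : C) (p : Hom E B).

Let pb (x : Slice B) : Pullback (sl_arr x) p := P (sl_arr x) p.

Definition pullback_obj (x : Slice B) : Slice E := {| sl_arr := pb_snd (pb x) |}.

Lemma pullback_map_comm (x y : Slice B) (f : Hom x y) :
  sl_arr y o (sl_hom f o pb_fst (pb x)) = p o pb_snd (pb x).
Proof. rewrite comp_assoc, sl_hom_arr; apply pb_comm. Qed.

Definition pullback_map (x y : Slice B) (f : Hom x y) :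
    Hom (pullback_obj x) (pullback_obj y) :=
  @Build_SliceHom C E (pullback_obj x) (pullback_obj y)
    (pb_lift (pb y) (pullback_map_comm f))
    (pb_lift_snd (pb y) (pullback_map_comm f)).

Lemma pullback_map_id (x : Slice B) :
  pullback_map (idm x) = idm (pullback_obj x).
Proof.
apply SliceHom_eq; simpl; apply (@pb_unique _ _ _ _ _ _ (pb x)).
- now rewrite pb_lift_fst, comp_idl, comp_idr.
- now rewrite pb_lift_snd, comp_idr.
Qed.

Lemma pullback_map_comp (x y z : Slice B) (g : Hom y z) (f : Hom x y) :
  pullback_map (g o f) = pullback_map g o pullback_map f.
Proof.
apply SliceHom_eq; simpl; apply (@pb_unique _ _ _ _ _ _ (pb z)).
- now rewrite comp_assoc, !pb_lift_fst, <- !comp_assoc, pb_lift_fst.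
- now rewrite comp_assoc, !pb_lift_snd.
Qed.

Definition pullback_functor : Functor (Slice B) (Slice E) := {|
  fobj := pullback_obj;
  fmap := pullback_map;
  fmap_id := pullback_map_id;
  fmap_comp := pullback_map_comp
|}.
End PullbackFunctor.

Definition effective_descent (C : Category) (P : HasPullbacks C) (E B : C)
  (p : Hom E B) : Prop := monadic (pullback_functor P p).

(* A category structure with set of objects O and set of arrows A, with
   composition defined on composable pairs: [cmp f g e] is "f, then g".  The
   laws quantify over all composability proofs, so that no transport along
   equalities of objects is ever needed. *)
Record CatStr (O A : Type) := {
  dom : A -> O;
  cod : A -> O;
  idn : O -> A;
  cmp : forall f g : A, cod f = dom g -> A;
  dom_idn : forall x, dom (idn x) = x;
  cod_idn : forall x, cod (idn x) = x;
  dom_cmp : forall f g (e : cod f = dom g), dom (cmp e) = dom f;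
  cod_cmp : forall f g (e : cod f = dom g), cod (cmp e) = cod g;
  cmp_idl : forall x f (e : cod (idn x) = dom f), cmp e = f;
  cmp_idr : forall f x (e : cod f = dom (idn x)), cmp e = f;
  cmp_assoc : forall f g h (e1 : cod f = dom g) (e2 : cod g = dom h)
    (e3 : cod (cmp e1) = dom h) (e4 : cod f = dom (cmp e2)),
    cmp e3 = cmp e4
}.

Arguments cmp {O A} c f g e.

Record preserves (O A O' A' : Type) (S : CatStr O A) (S' : CatStr O' A')
    (F0 : O -> O') (F1 : A -> A') : Prop := {
  pres_dom : forall f, dom S' (F1 f) = F0 (dom S f);
  pres_cod : forall f, cod S' (F1 f) = F0 (cod S f);
  pres_idn : forall x, F1 (idn S x) = idn S' (F0 x);
  pres_cmp : forall f g e e', F1 (cmp S f g e) = cmp S' (F1 f) (F1 g) e'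
}.

(* A strict 2-category as a set of objects, a set of 1-cells and a set of
   2-cells, with three category structures: 1-cells over objects ([one]),
   2-cells over 1-cells (vertical composition, [ver]), and 2-cells over objects
   (horizontal composition, [hor]). *)
Record TwoCategory := {
  cell0 : Type;
  cell1 : Type;
  cell2 : Type;
  one : CatStr cell0 cell1;
  ver : CatStr cell1 cell2;
  hor : CatStr cell0 cell2;
  dom_dom : forall a, dom one (dom ver a) = dom hor a;
  dom_cod : forall a, dom one (cod ver a) = dom hor a;
  cod_dom : forall a, cod one (dom ver a) = cod hor a;
  cod_cod : forall a, cod one (cod ver a) = cod hor a;
  idn_idn : forall x, idn ver (idn one x) = idn hor x;
  dom_hor : forall a b e e',
    dom ver (cmp hor a b e) = cmp one (dom ver a) (dom ver b) e';
  cod_hor : forall a b e e',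
    cod ver (cmp hor a b e) = cmp one (cod ver a) (cod ver b) e';
  hor_idn : forall f g e e',
    cmp hor (idn ver f) (idn ver g) e = idn ver (cmp one f g e');
  interchange : forall a a' b b'
    (ea : cod ver a = dom ver a') (eb : cod ver b = dom ver b')
    (e : cod hor (cmp ver a a' ea) = dom hor (cmp ver b b' eb))
    (e1 : cod hor a = dom hor b) (e2 : cod hor a' = dom hor b')
    (e3 : cod ver (cmp hor a b e1) = dom ver (cmp hor a' b' e2)),
    cmp hor (cmp ver a a' ea) (cmp ver b b' eb) e =
    cmp ver (cmp hor a b e1) (cmp hor a' b' e2) e3
}.

Record TwoFunctor (C D : TwoCategory) := {
  map0 : cell0 C -> cell0 D;
  map1 : cell1 C -> cell1 D;
  map2 : cell2 C -> cell2 D;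
  map_one : preserves (one C) (one D) map0 map1;
  map_ver : preserves (ver C) (ver D) map1 map2;
  map_hor : preserves (hor C) (hor D) map0 map2
}.

Lemma TwoFunctor_eq (C D : TwoCategory) (F G : TwoFunctor C D) :
  map0 F = map0 G -> map1 F = map1 G -> map2 F = map2 G -> F = G.
Proof.
destruct F, G; simpl; intros e0 e1 e2; subst; f_equal; apply proof_irrelevance.
Qed.

Lemma preserves_id (O A : Type) (S : CatStr O A) :
  preserves S S (fun x => x) (fun f => f).
Proof.
split; intros; try reflexivity; f_equal; apply proof_irrelevance.
Qed.

Lemma preserves_comp (O A O' A' O'' A'' : Type) (S : CatStr O A)
    (S' : CatStr O' A') (S'' : CatStr O'' A'') F0 F1 G0 G1 :
  preserves S' S'' G0 G1 -> preserves S S' F0 F1 ->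
  preserves S S'' (fun x => G0 (F0 x)) (fun f => G1 (F1 f)).
Proof.
intros HG HF; split; intros.
- now rewrite (pres_dom HG), (pres_dom HF).
- now rewrite (pres_cod HG), (pres_cod HF).
- now rewrite (pres_idn HF), (pres_idn HG).
- assert (e1 : cod S' (F1 f) = dom S' (F1 g))
    by now rewrite (pres_dom HF), (pres_cod HF), e.
  rewrite (pres_cmp HF e e1); apply (pres_cmp HG).
Qed.

Definition two_id (C : TwoCategory) : TwoFunctor C C := {|
  map0 := fun x => x;
  map1 := fun f => f;
  map2 := fun a => a;
  map_one := preserves_id (one C);
  map_ver := preserves_id (ver C);
  map_hor := preserves_id (hor C)
|}.

Definition two_comp (C D K : TwoCategory) (G : TwoFunctor D K)
    (F : TwoFunctor C D) : TwoFunctor C K := {|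
  map0 := fun x => map0 G (map0 F x);
  map1 := fun f => map1 G (map1 F f);
  map2 := fun a => map2 G (map2 F a);
  map_one := preserves_comp (map_one G) (map_one F);
  map_ver := preserves_comp (map_ver G) (map_ver F);
  map_hor := preserves_comp (map_hor G) (map_hor F)
|}.

Lemma two_comp_idl (C D : TwoCategory) (F : TwoFunctor C D) :
  two_comp (two_id D) F = F.
Proof. now apply TwoFunctor_eq. Qed.

Lemma two_comp_idr (C D : TwoCategory) (F : TwoFunctor C D) :
  two_comp F (two_id C) = F.
Proof. now apply TwoFunctor_eq. Qed.

Lemma two_comp_assoc (C D K L : TwoCategory) (H : TwoFunctor K L)
    (G : TwoFunctor D K) (F : TwoFunctor C D) :
  two_comp H (two_comp G F) = two_comp (two_comp H G) F.
Proof. now apply TwoFunctor_eq. Qed.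

(* Smallness: the cells of a [TwoCategory] live in one fixed universe, and
   [TwoCat] lives in a larger one. *)
Definition TwoCat : Category := {|
  Obj := TwoCategory;
  Hom := TwoFunctor;
  idm := two_id;
  comp := two_comp;
  comp_idl := two_comp_idl;
  comp_idr := two_comp_idr;
  comp_assoc := two_comp_assoc
|}.

Definition fib (X E B : Type) (q : X -> B) (p : E -> B) : Type :=
  { z : X * E | q (fst z) = p (snd z) }.

Definition fib_mk (X E B : Type) (q : X -> B) (p : E -> B) (x : X) (y : E)
    (h : q x = p y) : fib q p :=
  exist (fun z => q (fst z) = p (snd z)) (x, y) h.

Definition fib1 (X E B : Type) (q : X -> B) (p : E -> B) (z : fib q p) : X :=
  fst (proj1_sig z).

Definition fib2 (X E B : Type) (q : X -> B) (p : E -> B) (z : fib q p) : E :=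
  snd (proj1_sig z).

Lemma fib_eq (X E B : Type) (q : X -> B) (p : E -> B) (z w : fib q p) :
  fib1 z = fib1 w -> fib2 z = fib2 w -> z = w.
Proof.
destruct z as [[x y] h], w as [[x' y'] h']; unfold fib1, fib2; simpl.
intros e1 e2; subst; f_equal; apply proof_irrelevance.
Qed.

Section FibCatStr.
Variables (O1 A1 O2 A2 O A : Type).
Variables (S1 : CatStr O1 A1) (S2 : CatStr O2 A2) (S : CatStr O A).
Variables (q0 : O1 -> O) (q1 : A1 -> A) (p0 : O2 -> O) (p1 : A2 -> A).
Variables (Hq : preserves S1 S q0 q1) (Hp : preserves S2 S p0 p1).

Lemma fib_dom_eq (f : fib q1 p1) : q0 (dom S1 (fib1 f)) = p0 (dom S2 (fib2 f)).
Proof.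
rewrite <- (pres_dom Hq), <- (pres_dom Hp); f_equal; exact (proj2_sig f).
Qed.

Lemma fib_cod_eq (f : fib q1 p1) : q0 (cod S1 (fib1 f)) = p0 (cod S2 (fib2 f)).
Proof.
rewrite <- (pres_cod Hq), <- (pres_cod Hp); f_equal; exact (proj2_sig f).
Qed.

Lemma fib_idn_eq (x : fib q0 p0) : q1 (idn S1 (fib1 x)) = p1 (idn S2 (fib2 x)).
Proof.
rewrite (pres_idn Hq), (pres_idn Hp); f_equal; exact (proj2_sig x).
Qed.

Definition fib_dom (f : fib q1 p1) : fib q0 p0 := fib_mk (fib_dom_eq f).
Definition fib_cod (f : fib q1 p1) : fib q0 p0 := fib_mk (fib_cod_eq f).
Definition fib_idn (x : fib q0 p0) : fib q1 p1 := fib_mk (fib_idn_eq x).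

Lemma cmp_congr (f f' g g' : A) (e : cod S f = dom S g)
    (e' : cod S f' = dom S g') :
  f = f' -> g = g' -> cmp S f g e = cmp S f' g' e'.
Proof. intros; subst; f_equal; apply proof_irrelevance. Qed.

Lemma fib_cmp_eq (f g : fib q1 p1) (e : fib_cod f = fib_dom g) :
  q1 (cmp S1 (fib1 f) (fib1 g) (f_equal (@fib1 _ _ _ _ _) e)) =
  p1 (cmp S2 (fib2 f) (fib2 g) (f_equal (@fib2 _ _ _ _ _) e)).
Proof.
assert (e1 : cod S (q1 (fib1 f)) = dom S (q1 (fib1 g))).
{ rewrite (pres_dom Hq), (pres_cod Hq); f_equal.
  exact (f_equal (@fib1 _ _ _ _ _) e). }
assert (e2 : cod S (p1 (fib2 f)) = dom S (p1 (fib2 g))).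
{ rewrite (pres_dom Hp), (pres_cod Hp); f_equal.
  exact (f_equal (@fib2 _ _ _ _ _) e). }
rewrite (pres_cmp Hq _ e1), (pres_cmp Hp _ e2).
apply cmp_congr; [exact (proj2_sig f) | exact (proj2_sig g)].
Qed.

Definition fib_cmp (f g : fib q1 p1) (e : fib_cod f = fib_dom g) : fib q1 p1 :=
  fib_mk (fib_cmp_eq e).

Definition fib_CatStr : CatStr (fib q0 p0) (fib q1 p1).
Proof.
refine (@Build_CatStr _ _ fib_dom fib_cod fib_idn fib_cmp _ _ _ _ _ _ _);
  intros; apply fib_eq; cbn.
- apply dom_idn.
- apply dom_idn.
- apply cod_idn.
- apply cod_idn.
- apply dom_cmp.
- apply dom_cmp.
- apply cod_cmp.
- apply cod_cmp.
- apply cmp_idl.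
- apply cmp_idl.
- apply cmp_idr.
- apply cmp_idr.
- apply cmp_assoc.
- apply cmp_assoc.
Defined.

Lemma fib1_preserves : preserves fib_CatStr S1 (@fib1 _ _ _ _ _) (@fib1 _ _ _ _ _).
Proof.
split; try reflexivity; intros; cbn; f_equal; apply proof_irrelevance.
Qed.

Lemma fib2_preserves : preserves fib_CatStr S2 (@fib2 _ _ _ _ _) (@fib2 _ _ _ _ _).
Proof.
split; try reflexivity; intros; cbn; f_equal; apply proof_irrelevance.
Qed.

Lemma fib_lift_preserves (O' A' : Type) (S' : CatStr O' A') u0 u1 v0 v1
    (Hu : preserves S' S1 u0 u1) (Hv : preserves S' S2 v0 v1)
    (h0 : forall x, q0 (u0 x) = p0 (v0 x)) (h1 : forall f, q1 (u1 f) = p1 (v1 f)) :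
  preserves S' fib_CatStr (fun x => fib_mk (h0 x)) (fun f => fib_mk (h1 f)).
Proof.
split; intros; apply fib_eq; cbn.
- apply (pres_dom Hu).
- apply (pres_dom Hv).
- apply (pres_cod Hu).
- apply (pres_cod Hv).
- apply (pres_idn Hu).
- apply (pres_idn Hv).
- apply (pres_cmp Hu).
- apply (pres_cmp Hv).
Qed.
End FibCatStr.

Section TwoPullback.
Variables (X E B : TwoCategory) (q : TwoFunctor X B) (p : TwoFunctor E B).

Definition two_pb_obj : TwoCategory.
Proof.
refine (@Build_TwoCategory
  (fib (map0 q) (map0 p)) (fib (map1 q) (map1 p)) (fib (map2 q) (map2 p))
  (fib_CatStr (map_one q) (map_one p))
  (fib_CatStr (map_ver q) (map_ver p))
  (fib_CatStr (map_hor q) (map_hor p)) _ _ _ _ _ _ _ _ _);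
  intros; apply fib_eq; cbn.
- apply dom_dom.
- apply dom_dom.
- apply dom_cod.
- apply dom_cod.
- apply cod_dom.
- apply cod_dom.
- apply cod_cod.
- apply cod_cod.
- apply idn_idn.
- apply idn_idn.
- apply dom_hor.
- apply dom_hor.
- apply cod_hor.
- apply cod_hor.
- apply hor_idn.
- apply hor_idn.
- apply interchange.
- apply interchange.
Defined.

Definition two_pb_fst : TwoFunctor two_pb_obj X :=
  @Build_TwoFunctor two_pb_obj X (@fib1 _ _ _ _ _) (@fib1 _ _ _ _ _)
    (@fib1 _ _ _ _ _)
    (fib1_preserves (map_one q) (map_one p))
    (fib1_preserves (map_ver q) (map_ver p))
    (fib1_preserves (map_hor q) (map_hor p)).

Definition two_pb_snd : TwoFunctor two_pb_obj E :=
  @Build_TwoFunctor two_pb_obj E (@fib2 _ _ _ _ _) (@fib2 _ _ _ _ _)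
    (@fib2 _ _ _ _ _)
    (fib2_preserves (map_one q) (map_one p))
    (fib2_preserves (map_ver q) (map_ver p))
    (fib2_preserves (map_hor q) (map_hor p)).

Lemma two_pb_comm : two_comp q two_pb_fst = two_comp p two_pb_snd.
Proof.
apply TwoFunctor_eq; apply functional_extensionality; intros z;
  exact (proj2_sig z).
Qed.

Section Lift.
Variables (Z : TwoCategory) (u : TwoFunctor Z X) (v : TwoFunctor Z E).
Hypothesis e : two_comp q u = two_comp p v.

Let e0 x : map0 q (map0 u x) = map0 p (map0 v x) :=
  f_equal (fun F : TwoFunctor Z B => map0 F x) e.
Let e1 f : map1 q (map1 u f) = map1 p (map1 v f) :=
  f_equal (fun F : TwoFunctor Z B => map1 F f) e.
Let e2 a : map2 q (map2 u a) = map2 p (map2 v a) :=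
  f_equal (fun F : TwoFunctor Z B => map2 F a) e.

Definition two_pb_lift : TwoFunctor Z two_pb_obj :=
  @Build_TwoFunctor Z two_pb_obj
    (fun x => fib_mk (e0 x)) (fun f => fib_mk (e1 f)) (fun a => fib_mk (e2 a))
    (fib_lift_preserves (map_one q) (map_one p) (map_one u) (map_one v) e0 e1)
    (fib_lift_preserves (map_ver q) (map_ver p) (map_ver u) (map_ver v) e1 e2)
    (fib_lift_preserves (map_hor q) (map_hor p) (map_hor u) (map_hor v) e0 e2).

Lemma two_pb_lift_fst : two_comp two_pb_fst two_pb_lift = u.
Proof. now apply TwoFunctor_eq. Qed.

Lemma two_pb_lift_snd : two_comp two_pb_snd two_pb_lift = v.
Proof. now apply TwoFunctor_eq. Qed.
End Lift.

Lemma two_pb_unique (Z : TwoCategory) (h k : TwoFunctor Z two_pb_obj) :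
  two_comp two_pb_fst h = two_comp two_pb_fst k ->
  two_comp two_pb_snd h = two_comp two_pb_snd k -> h = k.
Proof.
intros H1 H2; apply TwoFunctor_eq; apply functional_extensionality; intros z;
  apply fib_eq.
- exact (f_equal (fun F : TwoFunctor Z X => map0 F z) H1).
- exact (f_equal (fun F : TwoFunctor Z E => map0 F z) H2).
- exact (f_equal (fun F : TwoFunctor Z X => map1 F z) H1).
- exact (f_equal (fun F : TwoFunctor Z E => map1 F z) H2).
- exact (f_equal (fun F : TwoFunctor Z X => map2 F z) H1).
- exact (f_equal (fun F : TwoFunctor Z E => map2 F z) H2).
Qed.

Definition two_pullback : @Pullback TwoCat X E B q p :=
  @Build_Pullback TwoCat X E B q p two_pb_obj two_pb_fst two_pb_snd two_pb_comm
    two_pb_lift two_pb_lift_fst two_pb_lift_snd two_pb_unique.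
End TwoPullback.

Definition TwoCat_pullbacks : HasPullbacks TwoCat := two_pullback.

Definition is_1cell (B : TwoCategory) (f : cell1 B) (x y : cell0 B) : Prop :=
  dom (one B) f = x /\ cod (one B) f = y.

Definition is_2cell (B : TwoCategory) (a : cell2 B) (f g : cell1 B) : Prop :=
  dom (ver B) a = f /\ cod (ver B) a = g.

Record is_vpair (B : TwoCategory) (x y : cell0 B) (f0 f1 f2 : cell1 B)
    (a1 a2 : cell2 B) : Prop := {
  vpair_f0 : is_1cell f0 x y;
  vpair_f1 : is_1cell f1 x y;
  vpair_f2 : is_1cell f2 x y;
  vpair_a1 : is_2cell a1 f0 f1;
  vpair_a2 : is_2cell a2 f1 f2
}.

Record is_vtriple (B : TwoCategory) (x y : cell0 B) (f0 f1 f2 f3 : cell1 B)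
    (a1 a2 a3 : cell2 B) : Prop := {
  vtriple_f0 : is_1cell f0 x y;
  vtriple_f1 : is_1cell f1 x y;
  vtriple_f2 : is_1cell f2 x y;
  vtriple_f3 : is_1cell f3 x y;
  vtriple_a1 : is_2cell a1 f0 f1;
  vtriple_a2 : is_2cell a2 f1 f2;
  vtriple_a3 : is_2cell a3 f2 f3
}.

(* [vt_fi], [vt_gi], [vt_ai], [vt_ci] are f_i, g_i, alpha_i, beta_i. *)
Record VTripleOfHPairs (B : TwoCategory) := {
  vt_b0 : cell0 B; vt_b1 : cell0 B; vt_b2 : cell0 B;
  vt_f0 : cell1 B; vt_f1 : cell1 B; vt_f2 : cell1 B; vt_f3 : cell1 B;
  vt_g0 : cell1 B; vt_g1 : cell1 B; vt_g2 : cell1 B; vt_g3 : cell1 B;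
  vt_a1 : cell2 B; vt_a2 : cell2 B; vt_a3 : cell2 B;
  vt_c1 : cell2 B; vt_c2 : cell2 B; vt_c3 : cell2 B;
  vt_a : is_vtriple vt_b0 vt_b1 vt_f0 vt_f1 vt_f2 vt_f3 vt_a1 vt_a2 vt_a3;
  vt_c : is_vtriple vt_b1 vt_b2 vt_g0 vt_g1 vt_g2 vt_g3 vt_c1 vt_c2 vt_c3
}.

(* [ht_fji] is f_{j,i} and [ht_aji] is alpha_{j,i} : f_{j,i-1} => f_{j,i}. *)
Record HTripleOfVPairs (B : TwoCategory) := {
  ht_b0 : cell0 B; ht_b1 : cell0 B; ht_b2 : cell0 B; ht_b3 : cell0 B;
  ht_f10 : cell1 B; ht_f11 : cell1 B; ht_f12 : cell1 B;
  ht_f20 : cell1 B; ht_f21 : cell1 B; ht_f22 : cell1 B;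
  ht_f30 : cell1 B; ht_f31 : cell1 B; ht_f32 : cell1 B;
  ht_a11 : cell2 B; ht_a12 : cell2 B;
  ht_a21 : cell2 B; ht_a22 : cell2 B;
  ht_a31 : cell2 B; ht_a32 : cell2 B;
  ht_1 : is_vpair ht_b0 ht_b1 ht_f10 ht_f11 ht_f12 ht_a11 ht_a12;
  ht_2 : is_vpair ht_b1 ht_b2 ht_f20 ht_f21 ht_f22 ht_a21 ht_a22;
  ht_3 : is_vpair ht_b2 ht_b3 ht_f30 ht_f31 ht_f32 ht_a31 ht_a32
}.

Section MapConfigurations.
Variables (E B : TwoCategory) (p : TwoFunctor E B).

Lemma map_1cell f x y : is_1cell f x y -> is_1cell (map1 p f) (map0 p x) (map0 p y).
Proof.
intros [e1 e2]; subst; split;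
  [apply (pres_dom (map_one p)) | apply (pres_cod (map_one p))].
Qed.

Lemma map_2cell a f g : is_2cell a f g -> is_2cell (map2 p a) (map1 p f) (map1 p g).
Proof.
intros [e1 e2]; subst; split;
  [apply (pres_dom (map_ver p)) | apply (pres_cod (map_ver p))].
Qed.

Lemma map_vpair x y f0 f1 f2 a1 a2 :
  is_vpair x y f0 f1 f2 a1 a2 ->
  is_vpair (map0 p x) (map0 p y) (map1 p f0) (map1 p f1) (map1 p f2)
    (map2 p a1) (map2 p a2).
Proof. intros []; split; auto using map_1cell, map_2cell. Qed.

Lemma map_vtriple x y f0 f1 f2 f3 a1 a2 a3 :
  is_vtriple x y f0 f1 f2 f3 a1 a2 a3 ->
  is_vtriple (map0 p x) (map0 p y) (map1 p f0) (map1 p f1) (map1 p f2)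
    (map1 p f3) (map2 p a1) (map2 p a2) (map2 p a3).
Proof. intros []; split; auto using map_1cell, map_2cell. Qed.

Definition map_VTriple (c : VTripleOfHPairs E) : VTripleOfHPairs B := {|
  vt_a := map_vtriple (vt_a c);
  vt_c := map_vtriple (vt_c c)
|}.

Definition map_HTriple (c : HTripleOfVPairs E) : HTripleOfVPairs B := {|
  ht_1 := map_vpair (ht_1 c);
  ht_2 := map_vpair (ht_2 c);
  ht_3 := map_vpair (ht_3 c)
|}.

Definition surjective_on_VTriples : Prop :=
  forall d : VTripleOfHPairs B, exists c : VTripleOfHPairs E, map_VTriple c = d.

Definition surjective_on_HTriples : Prop :=
  forall d : HTripleOfVPairs B, exists c : HTripleOfVPairs E, map_HTriple c = d.
End MapConfigurations.

(* Main.v *)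
(* The left adjoint of [p^*] is composition with [p], and an algebra for the
   induced monad is a 2-category [c : C -> E] over [E] with an action
   [(x, e) |-> act (x, e)], defined when [p (c x) = p e], that moves [x] into the
   fibre over [e].  The cells of [C] in each dimension are then the pullback of
   the set [A] of orbits along [p], because [p] is surjective on cells.
   A composable configuration of orbits has a composable image in [B]; lifting
   that image to [E] and moving representatives over the lift gives a composable
   configuration in [C].  Lifting composable pairs thus defines compositions on
   [A], lifting composable triples gives associativity, and lifting two-by-two
   grids gives interchange.  So the action comes from the 2-category [A] over [B].
   In the same way, [p^* x -> x] lifts composable pairs, hence is a regular
   epimorphism, which makes the comparison functor fully faithful. *)
From Stdlib Require Import FunctionalExtensionality ProofIrrelevance
  IndefiniteDescription.
Require Import Defs.

Set Implicit Arguments.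
Unset Strict Implicit.
Unset Printing Implicit Defensive.

Local Open Scope cat_scope.

(** Choice with its result in [Type], so that sections of surjections can serve in the construction
    of data. *)
Lemma choose (A : Type) (B : A -> Type) (R : forall x, B x -> Prop) :
  (forall x, exists y, R x y) -> {f : forall x, B x | forall x, R x (f x)}.
Proof.
intros H.
exists (fun x => proj1_sig (constructive_indefinite_description _ (H x))).
intros x; exact (proj2_sig (constructive_indefinite_description _ (H x))).
Qed.

(** * Equivalences and the adjunction between composition and pullback *)

Section Equivalences.
Variables (C D : Category) (F : Functor C D).
Hypothesis faithful : forall (x y : C) (f g : Hom x y),
  fmap F f = fmap F g -> f = g.
Hypothesis full : forall (x y : C) (h : Hom (F x) (F y)),
  exists f : Hom x y, fmap F f = h.
Hypothesis ess_surj : forall d : D,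
  exists (c : C) (f : Hom (F c) d), is_iso f.

Lemma faithful_full_iso (x y : C) (f : Hom x y) :
  is_iso (fmap F f) -> is_iso f.
Proof.
intros [g [e1 e2]]; destruct (full g) as [k <-].
exists k; split; apply faithful; now rewrite fmap_comp, fmap_id.
Qed.

Lemma fully_faithful_ess_surj_equivalence : is_equivalence F.
Proof.
destruct (choose (R := fun d (s : {c : C & (Hom (F c) d * Hom d (F c))%type}) =>
    snd (projT2 s) o fst (projT2 s) = idm _ /\
    fst (projT2 s) o snd (projT2 s) = idm _)) as [s Hs].
{ intros d; destruct (ess_surj d) as [c [f [g Hg]]].
  now exists (existT _ c (f, g)). }
pose (G0 d := projT1 (s d)).
pose (i d := fst (projT2 (s d)) : Hom (F (G0 d)) d).
pose (j d := snd (projT2 (s d)) : Hom d (F (G0 d))).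
assert (ji : forall d, j d o i d = idm _) by (intros d; apply Hs).
assert (ij : forall d, i d o j d = idm _) by (intros d; apply Hs).
clearbody i j; clear Hs.
pose (L x y (h : Hom (F x) (F y)) :=
  proj1_sig (constructive_indefinite_description _ (full h))).
assert (HL : forall x y (h : Hom (F x) (F y)), fmap F (L x y h) = h).
{ intros x y h.
  exact (proj2_sig (constructive_indefinite_description _ (full h))). }
clearbody L.
(* The inverse functor acts on maps by conjugation with the chosen isomorphisms, lifted along [F] by
   fullness. Its laws are checked after applying the faithful [F]. *)
pose (G1 d d' (h : Hom d d') := L _ _ (j d' o (h o i d))).
assert (G1id : forall d, G1 d d (idm d) = idm (G0 d)).
{ intros d; apply faithful; unfold G1.
  now rewrite HL, comp_idl, ji, fmap_id. }
assert (G1comp : forall x y z (g : Hom y z) (f : Hom x y),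
  G1 x z (g o f) = G1 y z g o G1 x y f).
{ intros; apply faithful; unfold G1.
  rewrite fmap_comp, !HL, !comp_assoc.
  now rewrite <- (comp_assoc (j z o g) (i y) (j y)), ij, comp_idr. }
pose (G := @Build_Functor D C G0 G1 G1id G1comp).
assert (tn : forall (x y : C) (f : Hom x y),
  L y (G0 (F y)) (j (F y)) o f = G1 _ _ (fmap F f) o L x (G0 (F x)) (j (F x))).
{ intros; apply faithful; unfold G1.
  rewrite !fmap_comp, !HL, <- !comp_assoc; now rewrite ij, comp_idr. }
assert (un : forall (x y : D) (h : Hom x y),
  i y o fmap F (G1 x y h) = h o i x).
{ intros; unfold G1; now rewrite HL, comp_assoc, ij, comp_idl. }
exists G.
exists (@Build_NatTrans C C (functor_id C) (functor_comp G F) _ tn).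
exists (@Build_NatTrans D D (functor_comp F G) (functor_id D) _ un).
split.
- intros x; apply faithful_full_iso; cbn; rewrite HL.
  now exists (i (F x)).
- intros d; cbn; now exists (j d).
Qed.
End Equivalences.

Lemma slice_iso (C : Category) (B : C) (x y : Slice B) (f : Hom x y) :
  is_iso (sl_hom f) -> is_iso f.
Proof.
intros [g [e1 e2]].
assert (Hg : sl_arr x o g = sl_arr y).
{ now rewrite <- (sl_hom_arr f), <- comp_assoc, e2, comp_idr. }
exists (Build_SliceHom Hg); split; now apply SliceHom_eq.
Qed.

Lemma alg_iso (X : Category) (T : Monad X) (a b : EilenbergMoore T)
  (f : Hom a b) : is_iso (alg_hom f) -> is_iso f.
Proof.
intros [g [e1 e2]].
assert (Hg : g o alg_act b = alg_act a o fmap T g).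
{ rewrite <- (comp_idr (alg_act b)), <- (fmap_id T), <- e2, fmap_comp.
  rewrite (comp_assoc (alg_act b)), <- (alg_hom_act f), !comp_assoc, e1.
  now rewrite comp_idl. }
exists (Build_AlgebraHom Hg); split; now apply AlgebraHom_eq.
Qed.

(** Essential surjectivity asks for an isomorphism out of a value of the comparison functor, while
    [comparison_alg_hom] builds a map into one. *)
Lemma iso_inverse_iso (C : Category) (x y : C) (f : Hom x y) :
  is_iso f -> exists g : Hom y x, is_iso g.
Proof. intros [g [e1 e2]]; exists g; now exists f. Qed.

Section SliceSum.
Variables (C : Category) (P : HasPullbacks C) (E B : C) (p : Hom E B).

Definition slice_sum_obj (x : Slice E) : Slice B := {| sl_arr := p o sl_arr x |}.

Lemma slice_sum_arr (x y : Slice E) (f : Hom x y) :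
  (p o sl_arr y) o sl_hom f = p o sl_arr x.
Proof. now rewrite <- comp_assoc, sl_hom_arr. Qed.

Definition slice_sum_map (x y : Slice E) (f : Hom x y) :
  Hom (slice_sum_obj x) (slice_sum_obj y) :=
  @Build_SliceHom C B (slice_sum_obj x) (slice_sum_obj y) (sl_hom f)
    (slice_sum_arr f).

Definition slice_sum : Functor (Slice E) (Slice B).
Proof.
refine (@Build_Functor (Slice E) (Slice B) slice_sum_obj slice_sum_map _ _);
  intros; now apply SliceHom_eq.
Defined.

Let U := pullback_functor P p.

Lemma sum_unit_comm (x : Slice E) :
  sl_arr (slice_sum x) o idm (sl_dom x) = p o sl_arr x.
Proof. apply comp_idr. Qed.

Definition sum_unit_map (x : Slice E) : Hom x (U (slice_sum x)) :=
  @Build_SliceHom C E x (U (slice_sum x))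
    (pb_lift (P (sl_arr (slice_sum x)) p) (sum_unit_comm x))
    (pb_lift_snd _ (sum_unit_comm x)).

Definition sum_counit_map (y : Slice B) : Hom (slice_sum (U y)) y :=
  @Build_SliceHom C B (slice_sum (U y)) y (pb_fst (P (sl_arr y) p))
    (pb_comm (P (sl_arr y) p)).

Definition sum_unit : NatTrans (functor_id (Slice E)) (functor_comp U slice_sum).
Proof.
refine (@Build_NatTrans _ _ (functor_id (Slice E)) (functor_comp U slice_sum)
  sum_unit_map _).
intros x y f; apply SliceHom_eq; cbn; apply pb_unique.
- rewrite !comp_assoc, !pb_lift_fst, <- comp_assoc, pb_lift_fst.
  now rewrite comp_idl, comp_idr.
- rewrite !comp_assoc, !pb_lift_snd; apply sl_hom_arr.
Defined.

Definition sum_counit : NatTrans (functor_comp slice_sum U) (functor_id (Slice B)).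
Proof.
refine (@Build_NatTrans _ _ (functor_comp slice_sum U) (functor_id (Slice B))
  sum_counit_map _).
intros x y f; apply SliceHom_eq; cbn; apply pb_lift_fst.
Defined.

Definition sum_pullback_adjunction : Adjunction slice_sum U.
Proof.
refine (@Build_Adjunction _ _ slice_sum U sum_unit sum_counit _ _).
- intros x; apply SliceHom_eq; cbn; apply pb_lift_fst.
- intros y; apply SliceHom_eq; cbn; apply pb_unique.
  + rewrite !comp_assoc, !pb_lift_fst, <- comp_assoc, pb_lift_fst.
    now rewrite !comp_idr.
  + now rewrite !comp_assoc, !pb_lift_snd, comp_idr.
Defined.
End SliceSum.

(** * Lifting composable configurations along a quotient *)

Definition surjective (A B : Type) (f : A -> B) : Prop :=
  forall y, exists x, f x = y.

Section Lifting.
Variables (O A O' A' : Type) (S : CatStr O A) (S' : CatStr O' A').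
Variables (q0 : O -> O') (q1 : A -> A').
Hypothesis Hq : preserves S S' q0 q1.

Definition lifts_pairs : Prop := forall F G, cod S' F = dom S' G ->
  exists f g, q1 f = F /\ q1 g = G /\ cod S f = dom S g.

Definition lifts_triples : Prop := forall F G H,
  cod S' F = dom S' G -> cod S' G = dom S' H ->
  exists f g h, q1 f = F /\ q1 g = G /\ q1 h = H /\
    cod S f = dom S g /\ cod S g = dom S h.

(** Appending an identity turns a pair into a triple. In the same way an arrow becomes a pair, and
    an object becomes an arrow, in the two lemmas that follow. *)
Lemma lifts_triples_pairs : lifts_triples -> lifts_pairs.
Proof.
intros L F G e.
destruct (L F G (idn S' (cod S' G)) e) as (f & g & h & ef & eg & _ & e' & _).
- now rewrite dom_idn.
- now exists f, g.
Qed.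

Lemma lifts_pairs_surjective1 : lifts_pairs -> surjective q1.
Proof.
intros L F.
destruct (L F (idn S' (cod S' F))) as (f & _ & ef & _).
- now rewrite dom_idn.
- now exists f.
Qed.

Lemma surjective1_surjective0 : surjective q1 -> surjective q0.
Proof.
intros L x; destruct (L (idn S' x)) as [f ef]; exists (dom S f).
now rewrite <- (pres_dom Hq), ef, dom_idn.
Qed.

(** Every composite in [S'] is the image of a composite in [S], where the hypothesis on [k0] and
    [k1] applies. *)
Lemma preserves_factor (O'' A'' : Type) (S'' : CatStr O'' A'')
    (k0 : O' -> O'') (k1 : A' -> A'') :
  lifts_pairs ->
  preserves S S'' (fun x => k0 (q0 x)) (fun f => k1 (q1 f)) ->
  preserves S' S'' k0 k1.
Proof.
intros L Hk; pose proof (lifts_pairs_surjective1 L) as s1.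
pose proof (surjective1_surjective0 s1) as s0.
split.
- intros F; destruct (s1 F) as [f <-].
  now rewrite (pres_dom Hk), (pres_dom Hq).
- intros F; destruct (s1 F) as [f <-].
  now rewrite (pres_cod Hk), (pres_cod Hq).
- intros X; destruct (s0 X) as [x <-].
  now rewrite <- (pres_idn Hk), (pres_idn Hq).
- intros F G e e'; destruct (L F G e) as (f & g & <- & <- & e'').
  now rewrite <- (pres_cmp Hq e''), (pres_cmp Hk e'' e').
Qed.
End Lifting.

(** * Category structures on quotients *)

Section QuotientCatStr.
Variables (O A O' A' : Type) (S : CatStr O A) (q0 : O -> O') (q1 : A -> A').

(** Conditions stated before [O'] and [A'] carry any structure, under which the structure of [S]
    descends to them. [qm_pair] makes composition defined on all composable pairs of classes, and
    [qm_triple] gives associativity. *)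
Record quotient_map : Prop := {
  qm_surj0 : surjective q0;
  qm_surj1 : surjective q1;
  qm_dom : forall f g, q1 f = q1 g -> q0 (dom S f) = q0 (dom S g);
  qm_cod : forall f g, q1 f = q1 g -> q0 (cod S f) = q0 (cod S g);
  qm_idn : forall x y, q0 x = q0 y -> q1 (idn S x) = q1 (idn S y);
  qm_cmp : forall f g f' g' e e', q1 f = q1 f' -> q1 g = q1 g' ->
    q1 (cmp S f g e) = q1 (cmp S f' g' e');
  qm_pair : forall f g, q0 (cod S f) = q0 (dom S g) ->
    exists f' g', q1 f' = q1 f /\ q1 g' = q1 g /\ cod S f' = dom S g';
  qm_triple : forall f g h,
    q0 (cod S f) = q0 (dom S g) -> q0 (cod S g) = q0 (dom S h) ->
    exists f' g' h', q1 f' = q1 f /\ q1 g' = q1 g /\ q1 h' = q1 h /\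
      cod S f' = dom S g' /\ cod S g' = dom S h'
}.

Lemma quotient_CatStr :
  quotient_map -> {S' : CatStr O' A' | preserves S S' q0 q1}.
Proof.
intros Q.
destruct (choose (qm_surj0 Q)) as [r0 Hr0].
destruct (choose (qm_surj1 Q)) as [r1 Hr1].
pose (d F := q0 (dom S (r1 F))).
pose (c F := q0 (cod S (r1 F))).
pose (i X := q1 (idn S (r0 X))).
assert (dE : forall f, d (q1 f) = q0 (dom S f)) by (intros; apply (qm_dom Q), Hr1).
assert (cE : forall f, c (q1 f) = q0 (cod S f)) by (intros; apply (qm_cod Q), Hr1).
assert (iE : forall x, i (q0 x) = q1 (idn S x)) by (intros; apply (qm_idn Q), Hr0).
clearbody d c i; clear r0 Hr0 r1 Hr1.
assert (pairs : forall F G, c F = d G ->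
  exists f g, F = q1 f /\ G = q1 g /\ cod S f = dom S g).
{ intros F G; destruct (qm_surj1 Q F) as [f <-], (qm_surj1 Q G) as [g <-].
  rewrite cE, dE; intros e; destruct (qm_pair Q e) as (f' & g' & e1 & e2 & e3).
  now exists f', g'. }
assert (ex : forall F G, c F = d G -> exists H, exists f g (e : cod S f = dom S g),
  F = q1 f /\ G = q1 g /\ H = q1 (cmp S f g e)).
{ intros F G E; destruct (pairs F G E) as (f & g & e1 & e2 & e3).
  exists (q1 (cmp S f g e3)), f, g, e3; auto. }
pose (m F G E := proj1_sig (constructive_indefinite_description _ (ex F G E))).
(* Independence of representatives: from here on [m] is computed on any convenient composable
   pair. *)
assert (mE : forall f g e F G E, F = q1 f -> G = q1 g ->
  m F G E = q1 (cmp S f g e)).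
{ intros f g e F G E HF HG; unfold m.
  destruct (constructive_indefinite_description _ (ex F G E))
    as (H & f' & g' & e' & H1 & H2 & H3); cbn; subst H.
  apply (qm_cmp Q); congruence. }
clearbody m; clear ex.
unshelve eexists.
- refine (@Build_CatStr O' A' d c i m _ _ _ _ _ _ _).
  + intros X; destruct (qm_surj0 Q X) as [x <-]; now rewrite iE, dE, dom_idn.
  + intros X; destruct (qm_surj0 Q X) as [x <-]; now rewrite iE, cE, cod_idn.
  + intros F G E; destruct (pairs F G E) as (f & g & -> & -> & e).
    now rewrite (mE f g e), !dE, dom_cmp.
  + intros F G E; destruct (pairs F G E) as (f & g & -> & -> & e).
    now rewrite (mE f g e), !cE, cod_cmp.
  + intros X F E; destruct (qm_surj1 Q F) as [f <-].
    destruct (qm_surj0 Q X) as [x <-].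
    (* The representative [x] need not be composable with [f]; it is replaced by [dom S f], which by
       [E] has the same class. *)
    assert (e : cod S (idn S (dom S f)) = dom S f) by apply cod_idn.
    rewrite (mE (idn S (dom S f)) f e); [now rewrite cmp_idl | | reflexivity].
    rewrite iE; apply (qm_idn Q).
    now rewrite iE, cE, cod_idn, dE in E.
  + intros F X E; destruct (qm_surj1 Q F) as [f <-].
    destruct (qm_surj0 Q X) as [x <-].
    assert (e : cod S f = dom S (idn S (cod S f))) by now rewrite dom_idn.
    rewrite (mE f (idn S (cod S f)) e); [now rewrite cmp_idr | reflexivity |].
    rewrite iE; apply (qm_idn Q).
    now rewrite iE, dE, dom_idn, cE in E.
  + intros F G H E1 E2 E3 E4.
    destruct (qm_surj1 Q F) as [f0 <-], (qm_surj1 Q G) as [g0 <-],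
      (qm_surj1 Q H) as [h0 <-].
    pose proof E1 as E1'; rewrite cE, dE in E1'.
    pose proof E2 as E2'; rewrite cE, dE in E2'.
    (* Both bracketings are computed on one composable triple of representatives. *)
    destruct (qm_triple Q E1' E2') as (f & g & h & ef & eg & eh & e1 & e2).
    assert (e3 : cod S (cmp S f g e1) = dom S h) by now rewrite cod_cmp.
    assert (e4 : cod S f = dom S (cmp S g h e2)) by now rewrite dom_cmp.
    rewrite (mE _ _ e3); [| now apply mE | now symmetry].
    rewrite (mE _ _ e4); [| now symmetry | now apply mE].
    f_equal; apply cmp_assoc.
- cbn; split; cbn; intros; auto.
  symmetry; now apply mE.
Qed.
End QuotientCatStr.

(** * Orbits of descent data *)

Section DescentQuotient.
Variables (C E B : Type) (c : C -> E) (p : E -> B).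
Variable act : fib (fun x => p (c x)) p -> C.

(** The laws of an algebra for the monad of [p], read pointwise in a single dimension. The last one
    says that moving twice is the same as moving at once to the final fibre. *)
Record fiber_action : Prop := {
  act_over : forall z, c (act z) = fib2 z;
  act_unit : forall x (h : p (c x) = p (c x)),
    act (fib_mk (q := fun x => p (c x)) h) = x;
  act_act : forall z (e : E) (h : p (c (act z)) = p e) (h' : p (c (fib1 z)) = p e),
    act (fib_mk (q := fun x => p (c x)) h) = act (fib_mk (q := fun x => p (c x)) h')
}.

(** [dq_lift] and [dq_eq] together say that [x |-> (q x, c x)] is a bijection from [C] onto the
    pullback of [b] along [p]. *)
Record descent_quotient (A : Type) (b : A -> B) (q : C -> A) : Prop := {
  dq_over : forall x, b (q x) = p (c x);
  dq_act : forall z, q (act z) = q (fib1 z);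
  dq_lift : forall a e, b a = p e -> exists x, q x = a /\ c x = e;
  dq_eq : forall x y, q x = q y -> c x = c y -> x = y
}.

(* The quotient is realised by the points lying over the image of a section of
   [p]; acting by that section is the quotient map. *)
Lemma descent_quotient_exists : surjective p -> fiber_action ->
  exists (A : Type) (b : A -> B) (q : C -> A), descent_quotient b q.
Proof.
intros sp H; destruct (choose sp) as [s Hs].
assert (h : forall x, p (c x) = p (s (p (c x)))) by (intros; now rewrite Hs).
pose (n x := act (fib_mk (q := fun x => p (c x)) (h x))).
assert (cn : forall x, c (n x) = s (p (c x))) by (intros; apply (act_over H)).
assert (pn : forall x, p (c (n x)) = p (c x)) by (intros; now rewrite cn, Hs).
assert (n_act : forall z, n (act z) = n (fib1 z)).
{ intros z; unfold n.
  assert (e : p (c (fib1 z)) = p (s (p (c (act z))))).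
  { rewrite Hs, (act_over H); exact (proj2_sig z). }
  rewrite (act_act H _ e); f_equal; apply fib_eq; cbn; [easy |].
  now rewrite e, Hs. }
(* Moving the normal form [n x] back over [c x] recovers [x], by [act_act] followed by
   [act_unit]. *)
assert (act_n : forall x z, fib1 z = n x -> fib2 z = c x -> act z = x).
{ intros x z e1 e2; rewrite <- (act_unit H (x := x) eq_refl).
  assert (k : p (c (n x)) = p (c x)) by apply pn.
  unfold n in k; rewrite <- (act_act H k).
  f_equal; now apply fib_eq. }
exists {x | c x = s (p (c x))}.
exists (fun a => p (c (proj1_sig a))).
assert (hn : forall x, c (n x) = s (p (c (n x)))).
{ intros; now rewrite pn, cn. }
exists (fun x => exist (fun x => c x = s (p (c x))) (n x) (hn x)).
assert (sub_eq : forall a a' : {x | c x = s (p (c x))},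
  proj1_sig a = proj1_sig a' -> a = a').
{ intros [x k] [y l]; cbn; intros e; subst; f_equal; apply proof_irrelevance. }
split.
- intros; cbn; apply pn.
- intros; apply sub_eq; apply n_act.
- intros [x k] e; cbn; intros l.
  exists (act (fib_mk (q := fun x => p (c x)) l)); split.
  + apply sub_eq; cbn; rewrite n_act; cbn.
    rewrite <- (act_unit H (x := x) eq_refl) at 2.
    unfold n; f_equal; apply fib_eq; cbn; [easy | now symmetry].
  + apply (act_over H).
- intros x y e1 e2; apply (f_equal (@proj1_sig _ _)) in e1; cbn in e1.
  rewrite <- (@act_n x _ (eq_refl : fib1 (fib_mk (q := fun x => p (c x)) (pn x)) = n x)
    eq_refl).
  apply act_n; cbn; [exact e1 | exact e2].
Qed.

Lemma descent_quotient_surjective (A : Type) (b : A -> B) (q : C -> A) :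
  surjective p -> descent_quotient b q -> surjective q.
Proof.
intros sp Q a; destruct (sp (b a)) as [e He].
destruct (dq_lift Q (eq_sym He)) as [x [Hx _]]; now exists x.
Qed.

(** Moving [x] over [c y] changes neither its class nor the prescribed fibre, so [dq_eq] identifies
    the result with [y]. Equality of classes thus becomes an instance of the action, to which
    preservation by the action applies. *)
Lemma descent_quotient_act_eq (A : Type) (b : A -> B) (q : C -> A) x y :
  fiber_action -> descent_quotient b q -> q x = q y ->
  exists h, y = act (@fib_mk _ _ _ (fun x => p (c x)) p x (c y) h).
Proof.
intros H Q e.
assert (h : p (c x) = p (c y)) by now rewrite <- !(dq_over Q), e.
exists h; apply (dq_eq Q); [now rewrite (dq_act Q) | now rewrite (act_over H)].
Qed.

(** Any representative of the class is moved into the required fibre. *)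
Lemma fiber_action_lift (A : Type) (b : A -> B) (q : C -> A) :
  fiber_action -> surjective q -> (forall x, b (q x) = p (c x)) ->
  (forall z, q (act z) = q (fib1 z)) ->
  forall z : fib b p, exists x, q x = fib1 z /\ c x = fib2 z.
Proof.
intros H s over qact z; destruct (s (fib1 z)) as [x Hx].
assert (r : p (c x) = p (fib2 z)).
{ rewrite <- over, Hx; exact (proj2_sig z). }
exists (act (fib_mk (q := fun x => p (c x)) r)).
now rewrite qact, (act_over H).
Qed.
End DescentQuotient.

Section DescentCatStr.
Variables (OC AC OE AE OB AB : Type).
Variables (SC : CatStr OC AC) (SE : CatStr OE AE) (SB : CatStr OB AB).
Variables (c0 : OC -> OE) (c1 : AC -> AE) (p0 : OE -> OB) (p1 : AE -> AB).
Hypotheses (Hc : preserves SC SE c0 c1) (Hp : preserves SE SB p0 p1).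
Hypothesis Hpc : preserves SC SB (fun x => p0 (c0 x)) (fun f => p1 (c1 f)).
Variable act0 : fib (fun x => p0 (c0 x)) p0 -> OC.
Variable act1 : fib (fun f => p1 (c1 f)) p1 -> AC.
Hypothesis Hact : preserves (fib_CatStr Hpc Hp) SC act0 act1.
Hypotheses (Fact0 : fiber_action act0) (Fact1 : fiber_action act1).
Variables (OA AA : Type) (b0 : OA -> OB) (b1 : AA -> AB).
Variables (q0 : OC -> OA) (q1 : AC -> AA).
Hypotheses (Q0 : descent_quotient act0 b0 q0) (Q1 : descent_quotient act1 b1 q1).

Lemma descent_dom f g : q1 f = q1 g -> q0 (dom SC f) = q0 (dom SC g).
Proof.
intros e; destruct (descent_quotient_act_eq Fact1 Q1 e) as [h ->].
now rewrite (pres_dom Hact), (dq_act Q0).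
Qed.

Lemma descent_cod f g : q1 f = q1 g -> q0 (cod SC f) = q0 (cod SC g).
Proof.
intros e; destruct (descent_quotient_act_eq Fact1 Q1 e) as [h ->].
now rewrite (pres_cod Hact), (dq_act Q0).
Qed.

Lemma descent_base_composable f g : q0 (cod SC f) = q0 (dom SC g) ->
  cod SB (b1 (q1 f)) = dom SB (b1 (q1 g)).
Proof.
intros e; apply (f_equal b0) in e; rewrite !(dq_over Q0) in e.
now rewrite !(dq_over Q1), (pres_cod Hpc), (pres_dom Hpc).
Qed.

(** The codomain and the domain have the same class and lie over the same object, so [dq_eq]
    applies. This is how composability in [SE] is transported to [SC]. *)
Lemma descent_composable f g : q0 (cod SC f) = q0 (dom SC g) ->
  cod SE (c1 f) = dom SE (c1 g) -> cod SC f = dom SC g.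
Proof.
intros e e'; apply (dq_eq Q0 e).
now rewrite <- (pres_cod Hc), <- (pres_dom Hc).
Qed.

Lemma descent_quotient_map :
  lifts_triples SE SB p1 -> quotient_map SC q0 q1.
Proof.
intros L3; pose proof (lifts_triples_pairs L3) as L2.
pose proof (lifts_pairs_surjective1 L2) as s1.
pose proof (surjective1_surjective0 Hp s1) as s0.
split.
- exact (descent_quotient_surjective s0 Q0).
- exact (descent_quotient_surjective s1 Q1).
- exact descent_dom.
- exact descent_cod.
- intros x y e; destruct (descent_quotient_act_eq Fact0 Q0 e) as [h ->].
  now rewrite <- (pres_idn Hact), (dq_act Q1).
- intros f g f' g' e e' ef eg.
  destruct (descent_quotient_act_eq Fact1 Q1 ef) as [hf Ef].
  destruct (descent_quotient_act_eq Fact1 Q1 eg) as [hg Eg].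
  (* The action sends [F] to [f'] and [G] to [g']. Since [F] and [G] are composable in the pullback
     and the action preserves composition, the second composite is the first one moved to another
     fibre. *)
  pose (F := @fib_mk _ _ _ (fun f => p1 (c1 f)) p1 f (c1 f') hf).
  pose (G := @fib_mk _ _ _ (fun f => p1 (c1 f)) p1 g (c1 g') hg).
  assert (E : cod (fib_CatStr Hpc Hp) F = dom (fib_CatStr Hpc Hp) G).
  { apply fib_eq; cbn; [exact e |].
    now rewrite (pres_cod Hc), (pres_dom Hc), e'. }
  assert (e'' : cod SC (act1 F) = dom SC (act1 G)).
  { now rewrite (pres_cod Hact), (pres_dom Hact), E. }
  rewrite (cmp_congr e' e'' Ef Eg), <- (pres_cmp Hact E), (dq_act Q1); cbn.
  f_equal; now apply cmp_congr.
- intros f g e.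
  (* The images in the base compose; their composable lift [u], [v] prescribes the fibres into which
     [f] and [g] are moved. *)
  destruct (L2 _ _ (descent_base_composable e)) as (u & v & eu & ev & e').
  destruct (dq_lift Q1 (eq_sym eu)) as (f' & ef & Cf).
  destruct (dq_lift Q1 (eq_sym ev)) as (g' & eg & Cg).
  exists f', g'; split; [easy | split; [easy |]]; apply descent_composable.
  + now rewrite (descent_cod ef), (descent_dom eg).
  + now rewrite Cf, Cg.
- intros f g h e1 e2.
  destruct (L3 _ _ _ (descent_base_composable e1) (descent_base_composable e2))
    as (u & v & w & eu & ev & ew & e1' & e2').
  destruct (dq_lift Q1 (eq_sym eu)) as (f' & ef & Cf).
  destruct (dq_lift Q1 (eq_sym ev)) as (g' & eg & Cg).
  destruct (dq_lift Q1 (eq_sym ew)) as (h' & eh & Ch).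
  exists f', g', h'; repeat (split; [easy |]);
    split; apply descent_composable.
  + now rewrite (descent_cod ef), (descent_dom eg).
  + now rewrite Cf, Cg.
  + now rewrite (descent_cod eg), (descent_dom eh).
  + now rewrite Cg, Ch.
Qed.
End DescentCatStr.

(** * Factorisation through 2-functors that lift composable pairs *)

Section TwoFunctorLifting.
Variables (C D : TwoCategory) (q : TwoFunctor C D).

Definition lifts_grids : Prop := forall a a' b b' : cell2 D,
  cod (ver D) a = dom (ver D) a' -> cod (ver D) b = dom (ver D) b' ->
  cod (hor D) a = dom (hor D) b -> cod (hor D) a' = dom (hor D) b' ->
  exists u u' v v' : cell2 C,
    map2 q u = a /\ map2 q u' = a' /\ map2 q v = b /\ map2 q v' = b' /\
    cod (ver C) u = dom (ver C) u' /\ cod (ver C) v = dom (ver C) v' /\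
    cod (hor C) u = dom (hor C) v /\ cod (hor C) u' = dom (hor C) v'.

Record lifts_composable_pairs : Prop := {
  lifts_one : lifts_pairs (one C) (one D) (map1 q);
  lifts_ver : lifts_pairs (ver C) (ver D) (map2 q);
  lifts_hor : lifts_pairs (hor C) (hor D) (map2 q)
}.

Hypothesis L : lifts_composable_pairs.

Lemma lifts_surjective2 : surjective (map2 q).
Proof. exact (lifts_pairs_surjective1 (lifts_hor L)). Qed.

Lemma lifts_surjective1 : surjective (map1 q).
Proof. exact (lifts_pairs_surjective1 (lifts_one L)). Qed.

Lemma lifts_surjective0 : surjective (map0 q).
Proof. exact (surjective1_surjective0 (map_one q) lifts_surjective1). Qed.

Lemma factor_exists (X Y Z : Type) (f : X -> Y) (g : X -> Z) :
  surjective f -> (forall x y, f x = f y -> g x = g y) ->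
  exists k : Y -> Z, (fun x => k (f x)) = g.
Proof.
intros s H; destruct (choose s) as [r Hr].
exists (fun y => g (r y)); apply functional_extensionality; intros x.
apply H, Hr.
Qed.

Lemma TwoFunctor_factor (Z : TwoCategory) (h : TwoFunctor C Z) :
  (forall x y, map0 q x = map0 q y -> map0 h x = map0 h y) ->
  (forall x y, map1 q x = map1 q y -> map1 h x = map1 h y) ->
  (forall x y, map2 q x = map2 q y -> map2 h x = map2 h y) ->
  exists k : TwoFunctor D Z, two_comp k q = h.
Proof.
intros H0 H1 H2.
destruct (factor_exists lifts_surjective0 H0) as [k0 E0].
destruct (factor_exists lifts_surjective1 H1) as [k1 E1].
destruct (factor_exists lifts_surjective2 H2) as [k2 E2].
destruct h as [h0 h1 h2 ho hv hh]; cbn in *; subst.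
exists (@Build_TwoFunctor D Z k0 k1 k2
  (preserves_factor (map_one q) (lifts_one L) ho)
  (preserves_factor (map_ver q) (lifts_ver L) hv)
  (preserves_factor (map_hor q) (lifts_hor L) hh)).
now apply TwoFunctor_eq.
Qed.

Lemma TwoFunctor_epi (Z : TwoCategory) (h k : TwoFunctor D Z) :
  two_comp h q = two_comp k q -> h = k.
Proof.
intros e; apply TwoFunctor_eq; apply functional_extensionality; intros y.
- destruct (lifts_surjective0 y) as [x <-].
  exact (f_equal (fun F : TwoFunctor C Z => map0 F x) e).
- destruct (lifts_surjective1 y) as [x <-].
  exact (f_equal (fun F : TwoFunctor C Z => map1 F x) e).
- destruct (lifts_surjective2 y) as [x <-].
  exact (f_equal (fun F : TwoFunctor C Z => map2 F x) e).
Qed.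
End TwoFunctorLifting.

Lemma bijective_lifts_pairs (O A O' A' : Type) (S : CatStr O A)
    (S' : CatStr O' A') q0 q1 : preserves S S' q0 q1 ->
  (forall x y, q0 x = q0 y -> x = y) -> surjective q1 -> lifts_pairs S S' q1.
Proof.
intros Hq i s F G; destruct (s F) as [f <-], (s G) as [g <-]; intros e.
exists f, g; split; [easy | split; [easy |]]; apply i.
now rewrite <- (pres_cod Hq), <- (pres_dom Hq).
Qed.

(** Such a [q] lifts composable pairs, so the identity of [C] factors through it, and the factor is
    the inverse. *)
Lemma bijective_TwoFunctor_iso (C D : TwoCategory) (q : TwoFunctor C D) :
  (forall x y, map0 q x = map0 q y -> x = y) ->
  (forall x y, map1 q x = map1 q y -> x = y) ->
  (forall x y, map2 q x = map2 q y -> x = y) ->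
  surjective (map1 q) -> surjective (map2 q) ->
  @is_iso TwoCat C D q.
Proof.
intros i0 i1 i2 s1 s2.
assert (L : lifts_composable_pairs q).
{ split.
  - exact (bijective_lifts_pairs (map_one q) i0 s1).
  - exact (bijective_lifts_pairs (map_ver q) i1 s2).
  - exact (bijective_lifts_pairs (map_hor q) i0 s2). }
destruct (TwoFunctor_factor L (h := two_id C)) as [k Hk]; auto.
exists k; split; [exact Hk |].
apply (TwoFunctor_epi L); cbn.
now rewrite <- two_comp_assoc, Hk, two_comp_idl, two_comp_idr.
Qed.

(** Lifting of pairs is stable under pullback: the image of the pair in [S] is lifted to [S2], and
    each arrow is matched with its lift. *)
Lemma fib1_lifts_pairs (O1 A1 O2 A2 O A : Type) (S1 : CatStr O1 A1)
    (S2 : CatStr O2 A2) (S : CatStr O A) q0 q1 p0 p1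
    (Hq : preserves S1 S q0 q1) (Hp : preserves S2 S p0 p1) :
  lifts_pairs S2 S p1 -> lifts_pairs (fib_CatStr Hq Hp) S1 (@fib1 _ _ _ q1 p1).
Proof.
intros L F G e.
destruct (L (q1 F) (q1 G)) as (u & v & eu & ev & e').
{ now rewrite (pres_cod Hq), (pres_dom Hq), e. }
exists (fib_mk (eq_sym eu)), (fib_mk (eq_sym ev)).
split; [easy | split; [easy |]]; now apply fib_eq.
Qed.

Lemma two_pb_fst_lifts_pairs (X E B : TwoCategory) (q : TwoFunctor X B)
    (p : TwoFunctor E B) :
  lifts_composable_pairs p -> lifts_composable_pairs (two_pb_fst q p).
Proof. intros []; split; now apply fib1_lifts_pairs. Qed.

(** * Quotients of 2-categories *)

Section QuotientTwoCategory.
Variables (C : TwoCategory) (A0 A1 A2 : Type).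
Variables (q0 : cell0 C -> A0) (q1 : cell1 C -> A1) (q2 : cell2 C -> A2).
Hypotheses (Q1 : quotient_map (one C) q0 q1) (Qv : quotient_map (ver C) q1 q2)
  (Qh : quotient_map (hor C) q0 q2).
Hypothesis grid : forall a a' b b' : cell2 C,
  q1 (cod (ver C) a) = q1 (dom (ver C) a') ->
  q1 (cod (ver C) b) = q1 (dom (ver C) b') ->
  q0 (cod (hor C) a) = q0 (dom (hor C) b) ->
  q0 (cod (hor C) a') = q0 (dom (hor C) b') ->
  exists u u' v v' : cell2 C,
    q2 u = q2 a /\ q2 u' = q2 a' /\ q2 v = q2 b /\ q2 v' = q2 b' /\
    cod (ver C) u = dom (ver C) u' /\ cod (ver C) v = dom (ver C) v' /\
    cod (hor C) u = dom (hor C) v /\ cod (hor C) u' = dom (hor C) v'.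

Lemma cod_dom_one_of_hor (a b : cell2 C) : cod (hor C) a = dom (hor C) b ->
  cod (one C) (dom (ver C) a) = dom (one C) (dom (ver C) b) /\
  cod (one C) (cod (ver C) a) = dom (one C) (cod (ver C) b).
Proof. intros e; now rewrite cod_dom, cod_cod, dom_dom, dom_cod. Qed.

Lemma quotient_lifts_pairs (O A O' A' : Type) (S : CatStr O A)
    (S' : CatStr O' A') (r0 : O -> O') (r1 : A -> A') :
  quotient_map S r0 r1 -> preserves S S' r0 r1 -> lifts_pairs S S' r1.
Proof.
intros Q H F G; destruct (qm_surj1 Q F) as [f <-], (qm_surj1 Q G) as [g <-].
rewrite (pres_cod H), (pres_dom H); apply (qm_pair Q).
Qed.

Lemma pres_cmp_eq (O A O' A' : Type) (S : CatStr O A) (S' : CatStr O' A')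
    (r0 : O -> O') (r1 : A -> A') f g e F G E :
  preserves S S' r0 r1 -> r1 f = F -> r1 g = G ->
  r1 (cmp S f g e) = cmp S' F G E.
Proof. intros H e1 e2; subst; apply (pres_cmp H). Qed.

(** Each law is checked on representatives whose composites exist in [C]. Interchange involves four
    cells that must be composable in both directions at once, which is what [grid] supplies. *)
Lemma quotient_TwoCategory : exists (D : TwoCategory) (q : TwoFunctor C D),
  lifts_composable_pairs q /\
  (forall x y, map0 q x = map0 q y <-> q0 x = q0 y) /\
  (forall x y, map1 q x = map1 q y <-> q1 x = q1 y) /\
  (forall x y, map2 q x = map2 q y <-> q2 x = q2 y).
Proof.
destruct (quotient_CatStr Q1) as [So Ho].
destruct (quotient_CatStr Qv) as [Sv Hv].
destruct (quotient_CatStr Qh) as [Sh Hh].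
unshelve refine (let D := @Build_TwoCategory A0 A1 A2 So Sv Sh _ _ _ _ _ _ _ _ _
  in _).
- intros F; destruct (qm_surj1 Qv F) as [f <-].
  now rewrite (pres_dom Hv), (pres_dom Hh), (pres_dom Ho), dom_dom.
- intros F; destruct (qm_surj1 Qv F) as [f <-].
  now rewrite (pres_cod Hv), (pres_dom Hh), (pres_dom Ho), dom_cod.
- intros F; destruct (qm_surj1 Qv F) as [f <-].
  now rewrite (pres_dom Hv), (pres_cod Hh), (pres_cod Ho), cod_dom.
- intros F; destruct (qm_surj1 Qv F) as [f <-].
  now rewrite (pres_cod Hv), (pres_cod Hh), (pres_cod Ho), cod_cod.
- intros X; destruct (qm_surj0 Q1 X) as [x <-].
  now rewrite <- (pres_idn Ho), <- (pres_idn Hv), <- (pres_idn Hh), idn_idn.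
- intros F G e e'.
  destruct (quotient_lifts_pairs Qh Hh e) as (f & g & <- & <- & l).
  destruct (cod_dom_one_of_hor l) as [l' _].
  rewrite <- (pres_cmp Hh l e), (pres_dom Hv), (dom_hor l l').
  apply (pres_cmp_eq _ _ Ho); symmetry; apply (pres_dom Hv).
- intros F G e e'.
  destruct (quotient_lifts_pairs Qh Hh e) as (f & g & <- & <- & l).
  destruct (cod_dom_one_of_hor l) as [_ l'].
  rewrite <- (pres_cmp Hh l e), (pres_cod Hv), (cod_hor l l').
  apply (pres_cmp_eq _ _ Ho); symmetry; apply (pres_cod Hv).
- intros F G e e'.
  destruct (quotient_lifts_pairs Q1 Ho e') as (f & g & <- & <- & l).
  assert (l' : cod (hor C) (idn (ver C) f) = dom (hor C) (idn (ver C) g)).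
  { now rewrite <- cod_dom, <- dom_dom, !dom_idn. }
  rewrite <- (pres_cmp Ho l e'), <- (pres_idn Hv), <- (hor_idn l' l).
  symmetry; apply (pres_cmp_eq _ _ Hh); apply (pres_idn Hv).
- intros F F' G G' eF eG e e1 e2 e3.
  destruct (qm_surj1 Qv F) as [a0 <-], (qm_surj1 Qv F') as [a0' <-].
  destruct (qm_surj1 Qv G) as [b0 <-], (qm_surj1 Qv G') as [b0' <-].
  destruct (grid (a := a0) (a' := a0') (b := b0) (b' := b0'))
    as (a & a' & b & b' & Ea & Ea' & Eb & Eb' & la & lb & l & l').
  { now rewrite <- (pres_cod Hv), <- (pres_dom Hv). }
  { now rewrite <- (pres_cod Hv), <- (pres_dom Hv). }
  { now rewrite <- (pres_cod Hh), <- (pres_dom Hh). }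
  { now rewrite <- (pres_cod Hh), <- (pres_dom Hh). }
  (* The classes are now those of the lifted grid, also inside the composability proofs. *)
  destruct Ea, Ea', Eb, Eb'.
  assert (m : cod (hor C) (cmp (ver C) a a' la) = dom (hor C) (cmp (ver C) b b' lb)).
  { now rewrite <- cod_dom, <- dom_dom, !dom_cmp, cod_dom, dom_dom. }
  assert (m' : cod (ver C) (cmp (hor C) a b l) = dom (ver C) (cmp (hor C) a' b' l')).
  { destruct (cod_dom_one_of_hor l) as [_ n], (cod_dom_one_of_hor l') as [n' _].
    rewrite (cod_hor l n), (dom_hor l' n'); now apply cmp_congr. }
  (* Both sides are the class of one cell of [C], by interchange in [C]. *)
  transitivity (q2 (cmp (hor C) _ _ m)).
  + symmetry; apply (pres_cmp_eq _ _ Hh); apply (pres_cmp Hv).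
  + rewrite (interchange m m').
    apply (pres_cmp_eq _ _ Hv); apply (pres_cmp Hh).
- exists D, (@Build_TwoFunctor C D q0 q1 q2 Ho Hv Hh).
  split; [split | now repeat split].
  + exact (quotient_lifts_pairs Q1 Ho).
  + exact (quotient_lifts_pairs Qv Hv).
  + exact (quotient_lifts_pairs Qh Hh).
Qed.
End QuotientTwoCategory.

(** * Lifting properties obtained from the two kinds of configurations *)

Section ConfigurationLifting.
Variables (E B : TwoCategory) (p : TwoFunctor E B).

Lemma is_1cell_dom_cod (C : TwoCategory) (f : cell1 C) :
  is_1cell f (dom (one C) f) (cod (one C) f).
Proof. now split. Qed.

(** Identity 2-cells let a single 1-cell, or below a single 2-cell, fill a column of a
    configuration. *)
Lemma constant_vpair (C : TwoCategory) (f : cell1 C) x y :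
  is_1cell f x y -> is_vpair x y f f f (idn (ver C) f) (idn (ver C) f).
Proof.
intros H; split; auto; split; first [apply dom_idn | apply cod_idn].
Qed.

Lemma right_unit_vpair (C : TwoCategory) (a : cell2 C) x y :
  dom (hor C) a = x -> cod (hor C) a = y ->
  is_vpair x y (dom (ver C) a) (cod (ver C) a) (cod (ver C) a)
    a (idn (ver C) (cod (ver C) a)).
Proof.
intros e1 e2; split; split; auto;
  first [now rewrite dom_dom | now rewrite dom_cod | now rewrite cod_dom
  | now rewrite cod_cod | apply dom_idn | apply cod_idn].
Qed.

Lemma composable_vtriple (C : TwoCategory) (a b c : cell2 C) x y :
  cod (ver C) a = dom (ver C) b -> cod (ver C) b = dom (ver C) c ->
  dom (hor C) a = x -> cod (hor C) a = y ->
  is_vtriple x y (dom (ver C) a) (dom (ver C) b) (dom (ver C) c)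
    (cod (ver C) c) a b c.
Proof.
intros e1 e2 <- <-.
assert (db : dom (hor C) b = dom (hor C) a) by now rewrite <- dom_dom, <- e1, dom_cod.
assert (cb : cod (hor C) b = cod (hor C) a) by now rewrite <- cod_dom, <- e1, cod_cod.
assert (dc : dom (hor C) c = dom (hor C) a) by now rewrite <- dom_dom, <- e2, dom_cod.
assert (cc : cod (hor C) c = cod (hor C) a) by now rewrite <- cod_dom, <- e2, cod_cod.
split; split; auto; rewrite ?dom_dom, ?cod_dom, ?dom_cod, ?cod_cod; auto.
Qed.

(** The grid is completed by a third row of identity 2-cells, and the first two rows of the lift are
    kept. *)
Lemma VTriples_lift_grids : surjective_on_VTriples p -> lifts_grids p.
Proof.
intros HV a a' b b' ea eb e e'.
assert (ida : cod (ver B) a' = dom (ver B) (idn (ver B) (cod (ver B) a'))).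
{ now rewrite dom_idn. }
assert (idb : cod (ver B) b' = dom (ver B) (idn (ver B) (cod (ver B) b'))).
{ now rewrite dom_idn. }
destruct (HV (Build_VTripleOfHPairs
  (composable_vtriple ea ida eq_refl eq_refl)
  (composable_vtriple eb idb (eq_sym e) eq_refl))) as [t Ht].
exists (vt_a1 t), (vt_a2 t), (vt_c1 t), (vt_c2 t).
split; [exact (f_equal (@vt_a1 B) Ht) |].
split; [exact (f_equal (@vt_a2 B) Ht) |].
split; [exact (f_equal (@vt_c1 B) Ht) |].
split; [exact (f_equal (@vt_c2 B) Ht) |].
destruct (vt_a t) as [[] [] [] _ [] [] _], (vt_c t) as [[] [] [] _ [] [] _].
rewrite <- !cod_dom, <- !dom_dom; repeat split; congruence.
Qed.

Lemma VTriples_lift_ver : surjective_on_VTriples p ->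
  lifts_triples (ver E) (ver B) (map2 p).
Proof.
intros HV a b c e e'.
(* The second column consists of three copies of the identity 2-cell on an identity 1-cell. *)
pose (i := idn (hor B) (cod (hor B) a)).
assert (ei : cod (ver B) i = dom (ver B) i).
{ unfold i; now rewrite <- idn_idn, cod_idn, dom_idn. }
destruct (HV (Build_VTripleOfHPairs
  (composable_vtriple e e' eq_refl eq_refl)
  (composable_vtriple ei ei (dom_idn _ _) (cod_idn _ _)))) as [t Ht].
exists (vt_a1 t), (vt_a2 t), (vt_a3 t).
split; [exact (f_equal (@vt_a1 B) Ht) |].
split; [exact (f_equal (@vt_a2 B) Ht) |].
split; [exact (f_equal (@vt_a3 B) Ht) |].
destruct (vt_a t) as [_ _ _ _ [] [] []]; split; congruence.
Qed.

Lemma HTriples_lift_one : surjective_on_HTriples p ->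
  lifts_triples (one E) (one B) (map1 p).
Proof.
intros HH f g h e e'.
destruct (HH (Build_HTripleOfVPairs
  (constant_vpair (conj eq_refl e)) (constant_vpair (conj eq_refl e'))
  (constant_vpair (is_1cell_dom_cod h)))) as [t Ht].
exists (ht_f10 t), (ht_f20 t), (ht_f30 t).
split; [exact (f_equal (@ht_f10 B) Ht) |].
split; [exact (f_equal (@ht_f20 B) Ht) |].
split; [exact (f_equal (@ht_f30 B) Ht) |].
destruct (ht_1 t) as [[] _ _ _ _], (ht_2 t) as [[] _ _ _ _],
  (ht_3 t) as [[] _ _ _ _]; split; congruence.
Qed.

(** The three 2-cells form the first row, above a row of identities. *)
Lemma HTriples_lift_hor : surjective_on_HTriples p ->
  lifts_triples (hor E) (hor B) (map2 p).
Proof.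
intros HH a b c e e'.
destruct (HH (Build_HTripleOfVPairs
  (right_unit_vpair eq_refl e) (right_unit_vpair eq_refl e')
  (right_unit_vpair (a := c) eq_refl eq_refl))) as [t Ht].
exists (ht_a11 t), (ht_a21 t), (ht_a31 t).
split; [exact (f_equal (@ht_a11 B) Ht) |].
split; [exact (f_equal (@ht_a21 B) Ht) |].
split; [exact (f_equal (@ht_a31 B) Ht) |].
destruct (ht_1 t) as [[] _ _ [] _], (ht_2 t) as [[] _ _ [] _],
  (ht_3 t) as [[] _ _ [] _].
rewrite <- !cod_dom, <- !dom_dom; split; congruence.
Qed.
End ConfigurationLifting.

(** * Effective descent in a category with pullbacks *)

Section ComparisonHom.
Variables (C : Category) (P : HasPullbacks C) (E B : C) (p : Hom E B).

Lemma pullback_map_fst (x y : Slice B) (f : Hom x y) :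
  pb_fst (P (sl_arr y) p) o sl_hom (fmap (pullback_functor P p) f) =
  sl_hom f o pb_fst (P (sl_arr x) p).
Proof. apply pb_lift_fst. Qed.

(* A map of algebras commutes with [(x, e, e') |-> (x, e')], so its first
   component at [(x, e)] does not depend on [e]. *)
Lemma comparison_hom_kernel (x y : Slice B)
  (h : Hom (comparison (sum_pullback_adjunction P p) x)
           (comparison (sum_pullback_adjunction P p) y))
  (Z : C) (u v : Hom Z (pb_obj (P (sl_arr x) p))) :
  pb_fst (P (sl_arr x) p) o u = pb_fst (P (sl_arr x) p) o v ->
  (pb_fst (P (sl_arr y) p) o sl_hom (alg_hom h)) o u =
  (pb_fst (P (sl_arr y) p) o sl_hom (alg_hom h)) o v.
Proof.
intros euv.
pose (D := P (p o pb_snd (P (sl_arr x) p)) p).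
assert (e : (pb_fst (P (sl_arr y) p) o sl_hom (alg_hom h)) o
    sl_hom (fmap (pullback_functor P p) (sum_counit_map P p x)) =
  (pb_fst (P (sl_arr y) p) o sl_hom (alg_hom h)) o pb_fst D).
{ pose proof (f_equal (fun u => sl_hom u) (alg_hom_act h)) as e; cbn in e.
  rewrite <- !comp_assoc; cbn; rewrite e, comp_assoc, pb_lift_fst, <- comp_assoc.
  now rewrite pb_lift_fst. }
(* For [u = (x, e)] and [v = (x, e')] this yields the triple [(x, e, e')]. Its first projection is
   [u], and forgetting [e] gives [v]. *)
assert (r : (p o pb_snd (P (sl_arr x) p)) o u = p o (pb_snd (P (sl_arr x) p) o v)).
{ now rewrite comp_assoc, <- pb_comm, <- !comp_assoc, euv. }
rewrite <- (pb_lift_fst D r), comp_assoc, <- e, <- comp_assoc.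
f_equal; apply pb_unique; cbn; rewrite comp_assoc, ?pb_lift_fst, ?pb_lift_snd.
- now rewrite <- comp_assoc, pb_lift_fst.
- reflexivity.
Qed.

Definition is_epi (C : Category) (x y : C) (f : Hom x y) : Prop :=
  forall (z : C) (g h : Hom y z), g o f = h o f -> g = h.

Lemma comparison_faithful_at (x y : Slice B) :
  is_epi (pb_fst (P (sl_arr x) p)) -> forall f g : Hom x y,
  fmap (comparison (sum_pullback_adjunction P p)) f =
  fmap (comparison (sum_pullback_adjunction P p)) g -> f = g.
Proof.
intros epi f g e; apply SliceHom_eq, epi; rewrite <- !pullback_map_fst.
exact (f_equal (fun h : Hom (comparison (sum_pullback_adjunction P p) x)
  (comparison (sum_pullback_adjunction P p) y) =>
  pb_fst (P (sl_arr y) p) o sl_hom (alg_hom h)) e).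
Qed.

Lemma comparison_full_at (x y : Slice B)
  (h : Hom (comparison (sum_pullback_adjunction P p) x)
           (comparison (sum_pullback_adjunction P p) y))
  (k : Hom (sl_dom x) (sl_dom y)) :
  is_epi (pb_fst (P (sl_arr x) p)) ->
  k o pb_fst (P (sl_arr x) p) = pb_fst (P (sl_arr y) p) o sl_hom (alg_hom h) ->
  exists f : Hom x y, fmap (comparison (sum_pullback_adjunction P p)) f = h.
Proof.
intros epi Hk.
assert (Hh : pb_snd (P (sl_arr y) p) o sl_hom (alg_hom h) =
  pb_snd (P (sl_arr x) p)) by exact (sl_hom_arr (alg_hom h)).
assert (Hs : sl_arr y o k = sl_arr x).
{ apply epi.
  rewrite (pb_comm (P (sl_arr x) p)), <- Hh, <- comp_assoc, Hk.
  now rewrite !comp_assoc, pb_comm. }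
exists (Build_SliceHom Hs); apply AlgebraHom_eq, SliceHom_eq, pb_unique; cbn.
- now rewrite pb_lift_fst.
- rewrite pb_lift_snd; exact (eq_sym Hh).
Qed.

Section AlgebraAction.
Variable a : Algebra (adj_monad (sum_pullback_adjunction P p)).

Let c := sl_arr (alg_obj a).
Let D := P (p o c) p.
Let act : Hom (pb_obj D) (sl_dom (alg_obj a)) := sl_hom (alg_act a).

Lemma alg_act_over : c o act = pb_snd D.
Proof. exact (sl_hom_arr (alg_act a)). Qed.

(** The unit law of the algebra for generalised elements: [w] has the form [(x, c x)]. *)
Lemma alg_act_unit (Z : C) (w : Hom Z (pb_obj D)) :
  pb_snd D o w = c o (pb_fst D o w) -> act o w = pb_fst D o w.
Proof.
intros e; pose proof (f_equal (fun u => sl_hom u) (alg_unit a)) as u; cbn in u.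
rewrite <- (comp_idl (pb_fst D o w)), <- u, <- comp_assoc; unfold act.
f_equal; apply pb_unique; fold D; rewrite comp_assoc.
- now rewrite pb_lift_fst, comp_idl.
- now rewrite pb_lift_snd.
Qed.

(** The associativity law for generalised elements: with [z = (x, e)], the elements [w] and [w'] are
    [(act z, e')] and [(x, e')]. *)
Lemma alg_act_act (Z : C) (w w' z : Hom Z (pb_obj D)) :
  pb_fst D o w = act o z -> pb_fst D o w' = pb_fst D o z ->
  pb_snd D o w = pb_snd D o w' -> act o w = act o w'.
Proof.
intros e1 e2 e3; pose proof (f_equal (fun u => sl_hom u) (alg_assoc a)) as u.
cbn in u.
pose (D' := P (p o pb_snd D) p).
(* This makes [(x, e, e')] an element of [D']. The functor of the monad applied to the action sends
   it to [w], and the multiplication sends it to [w']. *)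
assert (r : (p o pb_snd D) o z = p o (pb_snd D o w)).
{ transitivity ((p o c) o (pb_fst D o w)).
  - now rewrite e1, <- alg_act_over, !comp_assoc.
  - now rewrite !comp_assoc, (pb_comm D). }
transitivity ((act o pb_lift D (@pullback_map_comm C P E B p _ _
  (slice_sum_map p (alg_act a)))) o pb_lift D' r);
  [| transitivity ((act o pb_lift D (@pullback_map_comm C P E B p _ _
  (sum_counit_map P p (slice_sum p (alg_obj a))))) o pb_lift D' r)].
- rewrite <- comp_assoc; f_equal; apply pb_unique; rewrite comp_assoc.
  + rewrite pb_lift_fst, <- comp_assoc; fold D'; cbn; now rewrite pb_lift_fst.
  + now rewrite pb_lift_snd; cbn; rewrite pb_lift_snd.
- f_equal; exact (eq_sym u).
- rewrite <- comp_assoc; f_equal; apply pb_unique; rewrite comp_assoc.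
  + rewrite pb_lift_fst, <- comp_assoc; fold D'; cbn; now rewrite pb_lift_fst.
  + rewrite pb_lift_snd; cbn; now rewrite pb_lift_snd.
Qed.

(** The map into the pullback has components [q] and [c]. It respects the actions because [q] is
    constant on orbits and [act] lies over the second projection. *)
Lemma comparison_alg_hom (x : Slice B) (q : Hom (sl_dom (alg_obj a)) (sl_dom x))
    (e : sl_arr x o q = p o c) :
  q o act = q o pb_fst D ->
  exists f : Hom (a : EilenbergMoore _)
      (comparison (sum_pullback_adjunction P p) x),
    sl_hom (alg_hom f) = pb_lift (P (sl_arr x) p) e.
Proof.
intros eq.
pose (g := @Build_SliceHom C E (alg_obj a) (pullback_functor P p x)
  (pb_lift (P (sl_arr x) p) e) (pb_lift_snd _ e) :
  @Hom (Slice E) (alg_obj a) (pullback_functor P p x)).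
assert (Hg : g o alg_act a =
  alg_act (comparison (sum_pullback_adjunction P p) x) o
  fmap (adj_monad (sum_pullback_adjunction P p)) g).
{ apply SliceHom_eq; cbn; apply pb_unique; rewrite !comp_assoc.
  - rewrite !pb_lift_fst, <- comp_assoc, pb_lift_fst, comp_assoc, pb_lift_fst.
    exact eq.
  - rewrite !pb_lift_snd; exact alg_act_over. }
now exists (@Build_AlgebraHom _ _ a
  (comparison (sum_pullback_adjunction P p) x) g Hg).
Qed.
End AlgebraAction.

(** Only existence of the factorisation is required; uniqueness is [is_epi]. *)
Definition is_effective_epi (x y : C) (f : Hom x y) : Prop :=
  forall (z : C) (g : Hom x z),
    (forall (w : C) (u v : Hom w x), f o u = f o v -> g o u = g o v) ->
    exists k : Hom y z, k o f = g.

Record descent_datum (X : C) (c : Hom X E)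
    (act : Hom (pb_obj (P (p o c) p)) X) : Prop := {
  dd_over : c o act = pb_snd (P (p o c) p);
  dd_unit : forall (Z : C) (w : Hom Z (pb_obj (P (p o c) p))),
    pb_snd (P (p o c) p) o w = c o (pb_fst (P (p o c) p) o w) ->
    act o w = pb_fst (P (p o c) p) o w;
  dd_assoc : forall (Z : C) (w w' z : Hom Z (pb_obj (P (p o c) p))),
    pb_fst (P (p o c) p) o w = act o z ->
    pb_fst (P (p o c) p) o w' = pb_fst (P (p o c) p) o z ->
    pb_snd (P (p o c) p) o w = pb_snd (P (p o c) p) o w' -> act o w = act o w'
}.

Definition effective_datum (X : C) (c : Hom X E)
    (act : Hom (pb_obj (P (p o c) p)) X) : Prop :=
  exists (A : C) (b : Hom A B) (q : Hom X A) (e : b o q = p o c),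
    q o act = q o pb_fst (P (p o c) p) /\ is_iso (pb_lift (P b p) e).

(** The first condition makes the comparison functor faithful, the first two together make it full,
    and the third makes it essentially surjective. *)
Lemma effective_descent_criterion :
  (forall (X : C) (x : Hom X B), is_epi (pb_fst (P x p))) ->
  (forall (X : C) (x : Hom X B), is_effective_epi (pb_fst (P x p))) ->
  (forall (X : C) (c : Hom X E) (act : Hom (pb_obj (P (p o c) p)) X),
    descent_datum act -> effective_datum act) ->
  effective_descent P p.
Proof.
intros epi eff descent; exists (slice_sum p), (sum_pullback_adjunction P p).
apply fully_faithful_ess_surj_equivalence.
- intros x y f g; apply comparison_faithful_at, epi.
- intros x y h.
  destruct (eff _ (sl_arr x) _ (pb_fst (P (sl_arr y) p) o sl_hom (alg_hom h)))
    as [k Hk].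
  + intros w u v; apply comparison_hom_kernel.
  + exact (comparison_full_at (epi _ _) Hk).
- intros a.
  destruct (descent _ (sl_arr (alg_obj a)) (sl_hom (alg_act a)))
    as (A & b & q & e & qact & I).
  + split.
    * apply alg_act_over.
    * apply alg_act_unit.
    * apply alg_act_act.
  + destruct (@comparison_alg_hom a (@Build_SliceObj C B A b) q e qact) as [f Hf].
    exists (@Build_SliceObj C B A b).
    apply iso_inverse_iso with (f := f), alg_iso, slice_iso; rewrite Hf; exact I.
Qed.
End ComparisonHom.

(** * Effective descent of 2-functors *)

Lemma TwoFunctor_cell0 (C D : TwoCategory) (F G : TwoFunctor C D) :
  F = G -> forall x, map0 F x = map0 G x.
Proof. now intros ->. Qed.

Lemma TwoFunctor_cell1 (C D : TwoCategory) (F G : TwoFunctor C D) :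
  F = G -> forall x, map1 F x = map1 G x.
Proof. now intros ->. Qed.

Lemma TwoFunctor_cell2 (C D : TwoCategory) (F G : TwoFunctor C D) :
  F = G -> forall x, map2 F x = map2 G x.
Proof. now intros ->. Qed.

Section Descent.
Variables (E B : TwoCategory) (p : TwoFunctor E B).
Hypotheses (L1 : lifts_triples (one E) (one B) (map1 p))
  (Lv : lifts_triples (ver E) (ver B) (map2 p))
  (Lh : lifts_triples (hor E) (hor B) (map2 p))
  (Lg : lifts_grids p).

Lemma lifts_triples_composable_pairs : lifts_composable_pairs p.
Proof. split; now apply lifts_triples_pairs. Qed.

Let L := lifts_triples_composable_pairs.

Section DescentData.
Variables (C : TwoCategory) (c : TwoFunctor C E).
Let D := two_pb_obj (two_comp p c) p.
Let fst_D : TwoFunctor D C := two_pb_fst (two_comp p c) p.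
Let snd_D : TwoFunctor D E := two_pb_snd (two_comp p c) p.
Variable act : TwoFunctor D C.
Hypothesis over : two_comp c act = snd_D.
Hypothesis unit : forall (Z : TwoCategory) (w : TwoFunctor Z D),
  two_comp snd_D w = two_comp c (two_comp fst_D w) ->
  two_comp act w = two_comp fst_D w.
Hypothesis assoc : forall (Z : TwoCategory) (w w' z : TwoFunctor Z D),
  two_comp fst_D w = two_comp act z -> two_comp fst_D w' = two_comp fst_D z ->
  two_comp snd_D w = two_comp snd_D w' -> two_comp act w = two_comp act w'.

(** The laws for generalised elements are evaluated at universal ones and then read cell by cell. *)
Lemma act_fiber_action :
  fiber_action (map0 act) /\ fiber_action (map1 act) /\ fiber_action (map2 act).
Proof.
(* The universal element [(x, c x)], indexed by [C] itself. *)
pose (w0 := two_pb_lift (two_comp_idr (two_comp p c))).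
assert (unit' : two_comp act w0 = two_id C).
{ etransitivity; [apply unit |]; now apply TwoFunctor_eq. }
(* The universal case of associativity is indexed by the pairs of a cell [z] of [D] and a cell of
   [E] to which [act z] can be moved. *)
pose (r1 := two_pb_fst (two_comp p (two_comp c act)) p).
pose (r2 := two_pb_snd (two_comp p (two_comp c act)) p).
assert (e : two_comp (two_comp p c) (two_comp act r1) = two_comp p r2).
{ rewrite <- two_pb_comm; now apply TwoFunctor_eq. }
assert (e' : two_comp (two_comp p c) (two_comp fst_D r1) = two_comp p r2).
{ transitivity (two_comp (two_comp p snd_D) r1).
  - etransitivity; [apply two_comp_assoc |].
    exact (f_equal (fun F => two_comp F r1) (two_pb_comm (two_comp p c) p)).
  - rewrite <- over; exact (two_pb_comm (two_comp p (two_comp c act)) p). }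
assert (assoc' : two_comp act (two_pb_lift e) = two_comp act (two_pb_lift e')).
{ apply assoc with (z := r1); now apply TwoFunctor_eq. }
split; [| split].
- split.
  + exact (TwoFunctor_cell0 over).
  + intros x h; etransitivity; [| exact (TwoFunctor_cell0 unit' x)].
    now apply (f_equal (map0 act)), fib_eq.
  + intros z y h h'.
    etransitivity; [| etransitivity; [exact (TwoFunctor_cell0 assoc'
      (fib_mk (q := map0 (two_comp p (two_comp c act))) (x := z) h)) |]];
      now apply (f_equal (map0 act)), fib_eq.
- split.
  + exact (TwoFunctor_cell1 over).
  + intros x h; etransitivity; [| exact (TwoFunctor_cell1 unit' x)].
    now apply (f_equal (map1 act)), fib_eq.
  + intros z y h h'.
    etransitivity; [| etransitivity; [exact (TwoFunctor_cell1 assoc'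
      (fib_mk (q := map1 (two_comp p (two_comp c act))) (x := z) h)) |]];
      now apply (f_equal (map1 act)), fib_eq.
- split.
  + exact (TwoFunctor_cell2 over).
  + intros x h; etransitivity; [| exact (TwoFunctor_cell2 unit' x)].
    now apply (f_equal (map2 act)), fib_eq.
  + intros z y h h'.
    etransitivity; [| etransitivity; [exact (TwoFunctor_cell2 assoc'
      (fib_mk (q := map2 (two_comp p (two_comp c act))) (x := z) h)) |]];
      now apply (f_equal (map2 act)), fib_eq.
Qed.

Lemma descent_data_quotient :
  exists (A : TwoCategory) (b : TwoFunctor A B) (q : TwoFunctor C A)
    (e : two_comp b q = two_comp p c),
  two_comp q act = two_comp q fst_D /\ @is_iso TwoCat _ _ (two_pb_lift e).
Proof.
destruct act_fiber_action as (F0 & F1 & F2).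
destruct (descent_quotient_exists (lifts_surjective0 L) F0) as (A0 & b0 & q0 & D0).
destruct (descent_quotient_exists (lifts_surjective1 L) F1) as (A1 & b1 & q1 & D1).
destruct (descent_quotient_exists (lifts_surjective2 L) F2) as (A2 & b2 & q2 & D2).
pose proof (descent_quotient_map (map_one c) (map_one act) F0 F1 D0 D1 L1) as Q1.
pose proof (descent_quotient_map (map_ver c) (map_ver act) F1 F2 D1 D2 Lv) as Qv.
pose proof (descent_quotient_map (map_hor c) (map_hor act) F0 F2 D0 D2 Lh) as Qh.
destruct (quotient_TwoCategory Q1 Qv Qh) as (A & q & Lq & k0 & k1 & k2).
(* The grid of images in [B] is lifted to [E], and the four representatives are moved over the
   lift. *)
{ intros f f' g g' ef eg eh eh'.
  destruct (@Lg (b2 (q2 f)) (b2 (q2 f')) (b2 (q2 g)) (b2 (q2 g')))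
    as (u & u' & v & v' & Eu & Eu' & Ev & Ev' & lu & lv & l & l').
  { exact (descent_base_composable (map_ver (two_comp p c)) D1 D2 ef). }
  { exact (descent_base_composable (map_ver (two_comp p c)) D1 D2 eg). }
  { exact (descent_base_composable (map_hor (two_comp p c)) D0 D2 eh). }
  { exact (descent_base_composable (map_hor (two_comp p c)) D0 D2 eh'). }
  destruct (dq_lift D2 (eq_sym Eu)) as (t & Et & Ct).
  destruct (dq_lift D2 (eq_sym Eu')) as (t' & Et' & Ct').
  destruct (dq_lift D2 (eq_sym Ev)) as (s & Es & Cs).
  destruct (dq_lift D2 (eq_sym Ev')) as (s' & Es' & Cs').
  exists t, t', s, s'; do 4 (split; [easy |]).
  split; [| split; [| split]].
  - apply (descent_composable (map_ver c) D1); [| now rewrite Ct, Ct'].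
    now rewrite (qm_cod Qv Et), (qm_dom Qv Et').
  - apply (descent_composable (map_ver c) D1); [| now rewrite Cs, Cs'].
    now rewrite (qm_cod Qv Es), (qm_dom Qv Es').
  - apply (descent_composable (map_hor c) D0); [| now rewrite Ct, Cs].
    now rewrite (qm_cod Qh Et), (qm_dom Qh Es).
  - apply (descent_composable (map_hor c) D0); [| now rewrite Ct', Cs'].
    now rewrite (qm_cod Qh Et'), (qm_dom Qh Es'). }
destruct (TwoFunctor_factor Lq (h := two_comp p c)) as [b Hb].
{ intros x y exy; apply k0 in exy; cbn; now rewrite <- !(dq_over D0), exy. }
{ intros x y exy; apply k1 in exy; cbn; now rewrite <- !(dq_over D1), exy. }
{ intros x y exy; apply k2 in exy; cbn; now rewrite <- !(dq_over D2), exy. }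
assert (qact : two_comp q act = two_comp q fst_D).
{ apply TwoFunctor_eq; apply functional_extensionality; intros z; cbn.
  - apply k0, (dq_act D0).
  - apply k1, (dq_act D1).
  - apply k2, (dq_act D2). }
exists A, b, q, Hb; split; [exact qact |].
apply bijective_TwoFunctor_iso.
(* A cell of [C] is determined by its class and its image under [c]; this gives injectivity in each
   dimension. *)
- intros x y exy; apply (dq_eq D0).
  + exact (proj1 (k0 x y) (f_equal (@fib1 _ _ _ _ _) exy)).
  + exact (f_equal (@fib2 _ _ _ _ _) exy).
- intros x y exy; apply (dq_eq D1).
  + exact (proj1 (k1 x y) (f_equal (@fib1 _ _ _ _ _) exy)).
  + exact (f_equal (@fib2 _ _ _ _ _) exy).
- intros x y exy; apply (dq_eq D2).
  + exact (proj1 (k2 x y) (f_equal (@fib1 _ _ _ _ _) exy)).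
  + exact (f_equal (@fib2 _ _ _ _ _) exy).
- intros z; destruct (fiber_action_lift F1 (lifts_surjective1 Lq)
    (TwoFunctor_cell1 Hb) (TwoFunctor_cell1 qact) z) as (x & e1 & e2).
  exists x; now apply fib_eq.
- intros z; destruct (fiber_action_lift F2 (lifts_surjective2 Lq)
    (TwoFunctor_cell2 Hb) (TwoFunctor_cell2 qact) z) as (x & e1 & e2).
  exists x; now apply fib_eq.
Qed.
End DescentData.

(* Without this, conversion unfolds [two_pb_obj] before [pb_obj (two_pullback _ _)]
   and then compares the two 2-categories field by field. *)
Strategy 100 [two_pb_obj].

Lemma lifting_effective_descent :
  @effective_descent TwoCat TwoCat_pullbacks E B p.
Proof.
apply effective_descent_criterion.
- intros X x Z; apply (TwoFunctor_epi (two_pb_fst_lifts_pairs x L)).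
- intros X x Z g Hg.
  pose (f := two_pb_fst x p).
  (* Testing on the kernel pair of [f] shows that [g] identifies all cells that [f] identifies. *)
  pose proof (Hg (two_pb_obj f f) (two_pb_fst f f) (two_pb_snd f f) (two_pb_comm f f))
    as e.
  apply (TwoFunctor_factor (two_pb_fst_lifts_pairs x L)); intros z w ez.
  + exact (TwoFunctor_cell0 e (fib_mk (q := map0 f) (p := map0 f) ez)).
  + exact (TwoFunctor_cell1 e (fib_mk (q := map1 f) (p := map1 f) ez)).
  + exact (TwoFunctor_cell2 e (fib_mk (q := map2 f) (p := map2 f) ez)).
- intros X c act [over unit assoc].
  exact (descent_data_quotient over unit assoc).
Qed.
End Descent.

Theorem proposition4p1 (E B : TwoCategory) (p : TwoFunctor E B)
    (hV : surjective_on_VTriples p) (hH : surjective_on_HTriples p) :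
  @effective_descent TwoCat TwoCat_pullbacks E B p.
Proof.
apply lifting_effective_descent.
- exact (HTriples_lift_one hH).
- exact (VTriples_lift_ver hV).
- exact (HTriples_lift_hor hH).
- exact (VTriples_lift_grids hV).
Qed.
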